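(* Let $k\ge0$, $\ell\ge1$ be integers with $k+\ell\ge2$ and let $\psi$ be an $\mathrm{OptSP}_{k,\ell}$ formula. Then $\mathrm{Opt}(\psi)$ can be solved exactly in time $O(m^{k+\ell-1})$. Moreover, the values $\mathrm{Val}(x_1,\dots,x_k)$ for all tuples $(x_1,\dots,x_k)$ can be computed in the same running time.
   Context: A relational structure consists of a finite set of objects and relations on them of arbitrary fixed arities, given as an explicit list of all records; $m$ is the total number of records. An $\mathrm{OptSP}_{k,\ell}$ formula is $\psi=\mathrm{opt}_{x_1,\dots,x_k}\#\{(y_1,\dots,y_\ell):\phi(x_1,\dots,x_k,y_1,\dots,y_\ell)\}$ with $\mathrm{opt}\in\{\max,\min\}$ and $\phi$ a fixed quantifier-free Boolean combination of relational atoms over the variables; $\mathrm{Opt}(\psi)$ is the problem of computing the optimum value on a given structure, all variables ranging over the objects. $\mathrm{Val}(x_1,\dots,x_k)=\#\{(y_1,\dots,y_\ell):\phi(x_1,\dots,x_k,y_1,\dots,y_\ell)\}$. Constants depending on the formula are hidden in $O$-notation.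
   Formalization: The number of objects is assumed to be at most c·m for an arbitrary constant c (as when every object occurs in some record) and at least one; with unboundedly many objects in no record, the values for all tuples cannot be output in time bounded in m alone. *)

(* Defs.v *)
From HB Require Import structures.
From mathcomp Require Import all_boot.
Set Implicit Arguments.
Unset Strict Implicit.
Unset Printing Implicit Defensive.

(* The vocabulary has r relation symbols, the i-th of arity ar i.  A structure
   is given by the explicit list, without repetition and in arbitrary order, of
   the records of each relation; the objects are numbered 0, ..., nobj - 1. *)
Record structure (r : nat) (ar : 'I_r -> nat) := Structure {
  nobj : nat;
  records : forall i : 'I_r, seq ((ar i).-tuple 'I_nobj);
  nobj_gt0 : 0 < nobj;
  records_uniq : forall i, uniq (records i)
}.

Definition nrec (r : nat) (ar : 'I_r -> nat) (S : structure ar) : nat :=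
  \sum_(i < r) size (records S i).

(* Quantifier-free formulas in the variables 0, ..., q - 1. *)
Inductive qformula (r : nat) (ar : 'I_r -> nat) (q : nat) : Type :=
| Atom (i : 'I_r) (v : (ar i).-tuple 'I_q)
| Neg (f : qformula ar q)
| Conj (f g : qformula ar q)
| Disj (f g : qformula ar q).

Fixpoint holds (r : nat) (ar : 'I_r -> nat) (q : nat) (S : structure ar)
    (e : q.-tuple 'I_(nobj S)) (f : qformula ar q) : bool :=
  match f with
  | Atom i v => map_tuple (tnth e) v \in records S i
  | Neg g => ~~ holds e g
  | Conj g h => holds e g && holds e h
  | Disj g h => holds e g || holds e h
  end.

Inductive direction := Max | Min.

(* Among the k + l variables of the body, the first k are x_1, ..., x_k and the
   last l are y_1, ..., y_l. *)
Record optsp (r : nat) (ar : 'I_r -> nat) (k l : nat) := OptSP {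
  opt : direction;
  body : qformula ar (k + l)
}.

Definition Val (r : nat) (ar : 'I_r -> nat) (k l : nat) (psi : optsp ar k l)
    (S : structure ar) (x : k.-tuple 'I_(nobj S)) : nat :=
  #|[set y : l.-tuple 'I_(nobj S) | holds (cat_tuple x y) (body psi)]|.

Definition is_optimum (r : nat) (ar : 'I_r -> nat) (k l : nat)
    (psi : optsp ar k l) (S : structure ar) (v : nat) : Prop :=
  (exists x : k.-tuple 'I_(nobj S), Val psi x = v) /\
  (forall x : k.-tuple 'I_(nobj S),
     match opt psi with Max => Val psi x <= v | Min => v <= Val psi x end).

(* Word RAM with w-bit words: arithmetic is modulo 2 ^ w, every instruction
   takes one unit of time, and the machine halts when the program counter
   leaves the program. *)
Inductive instr :=
| SetC (d v : nat)       (* R[d] := v *)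
| Plus (d a b : nat)     (* R[d] := R[a] + R[b] *)
| Minus (d a b : nat)    (* R[d] := R[a] - R[b] *)
| Times (d a b : nat)    (* R[d] := R[a] * R[b] *)
| Read (d a : nat)       (* R[d] := M[R[a]] *)
| Write (a b : nat)      (* M[R[a]] := R[b] *)
| Jump (j : nat)         (* goto j *)
| JumpEq (a b j : nat)   (* if R[a] = R[b] goto j *)
| JumpLt (a b j : nat).  (* if R[a] < R[b] goto j *)

Record config := Config {
  pc : nat;
  reg : nat -> nat;
  memory : nat -> nat
}.

Definition set_reg (s : config) (d v : nat) : config :=
  Config (pc s).+1 [eta reg s with d |-> v] (memory s).

Definition set_mem (s : config) (a v : nat) : config :=
  Config (pc s).+1 (reg s) [eta memory s with a |-> v].

Definition goto (s : config) (b : bool) (j : nat) : config :=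
  Config (if b then j else (pc s).+1) (reg s) (memory s).

Definition exec (w : nat) (i : instr) (s : config) : config :=
  let R := reg s in
  match i with
  | SetC d v => set_reg s d (v %% 2 ^ w)
  | Plus d a b => set_reg s d ((R a + R b) %% 2 ^ w)
  | Minus d a b => set_reg s d ((R a + 2 ^ w - R b) %% 2 ^ w)
  | Times d a b => set_reg s d ((R a * R b) %% 2 ^ w)
  | Read d a => set_reg s d (memory s (R a))
  | Write a b => set_mem s (R a) (R b)
  | Jump j => goto s true j
  | JumpEq a b j => goto s (R a == R b) j
  | JumpLt a b j => goto s (R a < R b) j
  end.

Definition halted (P : seq instr) (s : config) : bool := size P <= pc s.

Definition step (w : nat) (P : seq instr) (s : config) : config :=
  if halted P s then s else exec w (nth (Jump 0) P (pc s)) s.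

Definition init (input : seq nat) : config :=
  Config 0 (fun=> 0) (nth 0 input).

(* The input is n followed, for each relation in turn, by its number of records
   and then these records, one entry per word. *)
Definition encode (r : nat) (ar : 'I_r -> nat) (S : structure ar) : seq nat :=
  nobj S ::
  flatten [seq size (records S i) ::
             flatten [seq [seq val o | o <- tval t] | t <- records S i]
          | i <- enum 'I_r].

(* A single program (depending only on the vocabulary and on the required
   output) runs in time O(T(m)) on all structures with n = O(m) objects and m
   records, on words of at least d * log(n + m + 2) bits for some constant d.
   If every object occurs in a record, then n <= c * m holds with c the largest
   arity; without any such bound the n ^ k values of Val could not even be
   written down in time O(m ^ (k + l - 1)). *)
Definition computable_in_time (r : nat) (ar : 'I_r -> nat) (T : nat -> nat)
    (output : structure ar -> config -> Prop) : Prop :=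
  exists (P : seq instr) (d : nat), forall c : nat, exists C : nat,
  forall S : structure ar, nobj S <= c * nrec S ->
  forall w : nat, (nobj S + nrec S + 2) ^ d <= 2 ^ w ->
  exists t : nat,
    let s := iter t (step w P) (init (encode S)) in
    [/\ t <= C * T (nrec S), halted P s & output S s].

Definition outputs_optimum (r : nat) (ar : 'I_r -> nat) (k l : nat)
    (psi : optsp ar k l) (S : structure ar) (s : config) : Prop :=
  is_optimum psi S (reg s 0).

(* Position of x in the row-major order on k-tuples over {0, ..., n - 1}. *)
Definition tuple_index (n k : nat) (x : k.-tuple 'I_n) : nat :=
  foldl (fun a (o : 'I_n) => a * n + o) 0 x.

(* All values are output as a table starting at the address in R[0]. *)
Definition outputs_values (r : nat) (ar : 'I_r -> nat) (k l : nat)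
    (psi : optsp ar k l) (S : structure ar) (s : config) : Prop :=
  forall x : k.-tuple 'I_(nobj S), memory s (reg s 0 + tuple_index x) = Val psi x.

(* Main.v *)
Require Import Defs.
From HB Require Import structures.
From mathcomp Require Import all_boot.
From mathcomp Require Import zify.
Set Implicit Arguments.
Unset Strict Implicit.
Unset Printing Implicit Defensive.

(* Single out the last variable y and enumerate only the other k + l - 1
   variables.  In the formula phi0 obtained from phi by declaring false all
   atoms that contain y together with another variable, an object y matters
   only through its type, i.e. the set of relations that hold at (y, ..., y);
   so for each of the 2 ^ r types the program counts the objects of that type,
   and adds this count to Val(x) once per assignment of the other variables
   that satisfies phi0 at that type.  An assignment where phi and phi0 differ
   satisfies a mixed atom, hence y and some other variable z take values from
   the record of that atom: for each of the m records and each choice of two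
   positions for z and y, the program enumerates the remaining k + l - 2
   variables and adds phi - phi0 to Val(x), marking assignments so as to correct
   each of them once.

   As the memory beyond the input is zero, membership of a tuple in a relation,
   the marks and the values are looked up in directly addressed arrays of
   n ^ O(1) cells. *)

(** * Program logic *)

(** There are n ^ (k + l) assignments, too many to visit within the bound. Replacing the last
    variable by its type leaves n ^ (k + l - 1) of them for each of the constantly many types, and
    fixing two variables by a record leaves m * n ^ (k + l - 2); both are at most (n + m) ^ (k + l -
    1), and n = O(m) is used only at the very end. One assignment may be reached from several
    records and position pairs, so adding corrections blindly would overcount. Marks remove the
    repetition without inclusion-exclusion; their array has at least n ^ (k + l) cells, but it is
    never cleared, and only the cells of visited assignments are touched.

    The invariant of the correction phase is a sum over all assignments, in which the marked ones
    count with phi and the others with phi0. It equals the output of the type phase when nothing is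
    marked, and Val once every assignment satisfying a mixed atom is marked. Values are tracked
    modulo 2 ^ w only: the final ones lie below 2 ^ w, so intermediate sums and differences need no
    bounds. *)

Definition upd (f : nat -> nat) (d v : nat) : nat -> nat :=
  fun x => if x == d then v else f x.

Lemma upd_eq f d v : upd f d v d = v.
Proof. by rewrite /upd eqxx. Qed.

Lemma upd_neq f d v x : x != d -> upd f d v x = f x.
Proof. by rewrite /upd => /negPf ->. Qed.

(** The frame condition of the register stack: a fragment placed at depth [d] leaves everything
    below [d] intact. *)
Definition agree_below (d : nat) (R R' : nat -> nat) : Prop :=
  forall x, x < d -> R' x = R x.

Lemma agree_below_trans d R1 R2 R3 :
  agree_below d R1 R2 -> agree_below d R2 R3 -> agree_below d R1 R3.
Proof. by move=> h1 h2 x hx; rewrite h2 // h1. Qed.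

Lemma agree_below_leq d d' R R' :
  d <= d' -> agree_below d' R R' -> agree_below d R R'.
Proof. by move=> hd h x hx; apply: h; apply: leq_trans hd. Qed.

Lemma agree_below_upd d R R' x v :
  agree_below d R R' -> d <= x -> agree_below d R (upd R' x v).
Proof. by move=> h hd y hy; rewrite upd_neq ?h //; lia. Qed.

Definition straight_step (w : nat) (RM : (nat -> nat) * (nat -> nat))
    (i : instr) :=
  let s := exec w i (Config 0 RM.1 RM.2) in (reg s, memory s).

Definition sp (w : nat) (s : seq instr) (R M : nat -> nat)
    (Q : (nat -> nat) -> (nat -> nat) -> Prop) : Prop :=
  let RM := foldl (straight_step w) (R, M) s in Q RM.1 RM.2.

Definition code := nat -> seq instr.

(* The fragment [c] is relocatable: its argument is the address at which it is
   placed. *)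
Definition wp (w : nat) (c : code) (t : nat) (R M : nat -> nat)
    (Q : (nat -> nat) -> (nat -> nat) -> Prop) : Prop :=
  forall pre post : seq instr,
  exists t' R' M',
    [/\ t' <= t,
        iter t' (step w (pre ++ c (size pre) ++ post)) (Config (size pre) R M)
        = Config (size pre + size (c (size pre))) R' M'
      & Q R' M'].

Definition is_straight (i : instr) : bool :=
  match i with Jump _ | JumpEq _ _ _ | JumpLt _ _ _ => false | _ => true end.

Section ProgramLogic.
Variable w : nat.

Lemma sp_mono s R M (Q Q' : _ -> _ -> Prop) :
  sp w s R M Q -> (forall R' M', Q R' M' -> Q' R' M') -> sp w s R M Q'.
Proof. by move=> h hQ; apply: hQ. Qed.

Lemma sp_nil R M (Q : _ -> _ -> Prop) : Q R M -> sp w [::] R M Q.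
Proof. by []. Qed.

Lemma sp_set d v s R M Q :
  v < 2 ^ w -> sp w s (upd R d v) M Q -> sp w (SetC d v :: s) R M Q.
Proof. by move=> hv h; rewrite /sp /= /straight_step /= modn_small. Qed.

(** Arithmetic has two rules per instruction. The forms ending in [m] keep the residue and serve the
    counters; the plain forms ask for the absence of overflow and serve addresses, loop bounds and
    Booleans. *)
Lemma sp_plusm d a b s R M Q :
  sp w s (upd R d ((R a + R b) %% 2 ^ w)) M Q -> sp w (Plus d a b :: s) R M Q.
Proof. by []. Qed.

Lemma sp_plus d a b s R M Q :
  R a + R b < 2 ^ w -> sp w s (upd R d (R a + R b)) M Q ->
  sp w (Plus d a b :: s) R M Q.
Proof. by move=> hv h; apply: sp_plusm; rewrite modn_small. Qed.

Lemma sp_minusm d a b s R M Q :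
  sp w s (upd R d ((R a + 2 ^ w - R b) %% 2 ^ w)) M Q ->
  sp w (Minus d a b :: s) R M Q.
Proof. by []. Qed.

Lemma sp_minus d a b s R M Q :
  R b <= R a -> R a < 2 ^ w -> sp w s (upd R d (R a - R b)) M Q ->
  sp w (Minus d a b :: s) R M Q.
Proof.
move=> hb hv h; apply: sp_minusm.
have -> : R a + 2 ^ w - R b = R a - R b + 2 ^ w by lia.
by rewrite modnDr modn_small //; lia.
Qed.

Lemma sp_timesm d a b s R M Q :
  sp w s (upd R d ((R a * R b) %% 2 ^ w)) M Q -> sp w (Times d a b :: s) R M Q.
Proof. by []. Qed.

Lemma sp_times d a b s R M Q :
  R a * R b < 2 ^ w -> sp w s (upd R d (R a * R b)) M Q ->
  sp w (Times d a b :: s) R M Q.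
Proof. by move=> hv h; apply: sp_timesm; rewrite modn_small. Qed.

Lemma sp_read d a s R M Q :
  sp w s (upd R d (M (R a))) M Q -> sp w (Read d a :: s) R M Q.
Proof. by []. Qed.

Lemma sp_write a b s R M Q :
  sp w s R (upd M (R a) (R b)) Q -> sp w (Write a b :: s) R M Q.
Proof. by []. Qed.

Lemma wp_mono c t t' R M (Q Q' : _ -> _ -> Prop) :
  wp w c t R M Q -> t <= t' -> (forall R' M', Q R' M' -> Q' R' M') ->
  wp w c t' R M Q'.
Proof.
move=> h ht hQ pre post; have [u [R' [M' [hu e q]]]] := h pre post.
by exists u, R', M'; split; [apply: leq_trans ht| |apply: hQ].
Qed.

Definition cseq (c1 c2 : code) : code :=
  fun off => c1 off ++ c2 (off + size (c1 off)).

(** Each fragment is run with the other one absorbed into its surroundings: [c2] joins the suffix of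
    [c1], and [c1] the prefix of [c2]. This is why [wp] quantifies over [pre] and [post]. *)
Lemma wp_seq c1 c2 t1 t2 R M Q :
  wp w c1 t1 R M (fun R' M' => wp w c2 t2 R' M' Q) ->
  wp w (cseq c1 c2) (t1 + t2) R M Q.
Proof.
move=> h pre post; set off := size pre.
have [u1 [R1 [M1 [hu1 e1 h2]]]] := h pre (c2 (off + size (c1 off)) ++ post).
have [u2 [R2 [M2 [hu2 e2 q]]]] := h2 (pre ++ c1 off) post.
exists (u2 + u1), R2, M2; split; [by lia| |by []].
move: e1 e2; rewrite /cseq iterD size_cat -/off -!catA => -> ->.
by rewrite size_cat addnA.
Qed.

Lemma step_at pre s post k R M :
  k < size s ->
  step w (pre ++ s ++ post) (Config (size pre + k) R M)
  = exec w (nth (Jump 0) s k) (Config (size pre + k) R M).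
Proof.
move=> hk; rewrite /step /halted /= !size_cat ifN; last by lia.
by rewrite !nth_cat ltnNge leq_addr /= addKn hk.
Qed.

Definition block (s : seq instr) : code := fun=> s.

Lemma wp_block s R M Q :
  all is_straight s -> sp w s R M Q -> wp w (block s) (size s) R M Q.
Proof.
elim: s R M => [|i s IH] R M /=.
  by move=> _ q pre post; exists 0, R, M; split; rewrite //= addn0.
move=> /andP [hi hs] h pre post.
set RM := straight_step w (R, M) i.
have [u [R' [M' [hu e q]]]] := IH RM.1 RM.2 hs h (rcons pre i) post.
exists u.+1, R', M'; split => //.
have H := @step_at pre (i :: s) post 0 R M; rewrite addn0 in H.
rewrite iterSr {}H //.
move: e; rewrite size_rcons cat_rcons /block addnS -addSn => <-.
by congr iter; case: i hi {h} @RM.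
Qed.

(** Jump targets are absolute, hence the offsets. The test jumps over the exit jump into the body,
    and the increment relies on register 1 holding 1. *)
Definition cfor (x lim : nat) (body : code) : code := fun off =>
  let b := body off.+3 in
  [:: SetC x 0; JumpLt x lim off.+3; Jump (off + (size b + 5))] ++ b ++
  [:: Plus x x 1; Jump off.+1].

(** Each round pays for the test, the increment and the jump back; the last 3 steps are the
    initialization, the failing test and the exit jump. The body must restore the counter, the limit
    and the constant in register 1. *)
Lemma wp_for x lim body t N (I : nat -> _ -> _ -> Prop) R M :
  x != lim -> R lim = N -> N < 2 ^ w ->
  (forall j R M, j < N -> R x = j -> R lim = N -> I j R M ->
     wp w body t R M (fun R' M' =>
       [/\ R' x = j, R' lim = N, R' 1 = 1 & I j.+1 (upd R' x j.+1) M'])) ->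
  I 0 (upd R x 0) M ->
  wp w (cfor x lim body) (N * (t + 3) + 3) R M (fun R' M' => I N R' M').
Proof.
move=> hx hlim hN hbody h0 pre post.
set off := size pre; set b := body off.+3.
set P := pre ++ _.
have HP k R1 M1 : k < size b + 5 -> step w P (Config (off + k) R1 M1) =
    exec w (nth (Jump 0) (cfor x lim body off) k) (Config (off + k) R1 M1).
  by move=> hk; rewrite step_at // /cfor -/b /= size_cat /=; lia.
have nthE k : nth (Jump 0) (cfor x lim body off) (size b + 3 + k) =
    nth (Jump 0) [:: Plus x x 1; Jump off.+1] k.
  by rewrite /cfor -/b addnAC addn3 /= nth_cat ltnNge leq_addr addKn.
have H1 R1 M1 : step w P (Config off R1 M1) = Config off.+1 (upd R1 x 0) M1.
  by have := HP 0 R1 M1; rewrite addn0 => -> //=; [rewrite /set_reg /= mod0n|lia].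
have H2 R1 M1 : step w P (Config off.+1 R1 M1) =
    Config (if R1 x < R1 lim then off.+3 else off.+2) R1 M1.
  by have := HP 1 R1 M1; rewrite addn1 => -> //; lia.
have H3 R1 M1 : step w P (Config off.+2 R1 M1) =
    Config (off + (size b + 5)) R1 M1.
  by have := HP 2 R1 M1; rewrite addn2 => -> //; lia.
have H4 R1 M1 : R1 1 = 1 -> step w P (Config (off.+3 + size b) R1 M1) =
    Config (off + (size b + 4)) (upd R1 x ((R1 x + 1) %% 2 ^ w)) M1.
  move=> h1; have -> : off.+3 + size b = off + (size b + 3 + 0) by lia.
  rewrite HP ?nthE /= /set_reg /= ?h1; last by lia.
  by congr Config; lia.
have H5 R1 M1 : step w P (Config (off + (size b + 4)) R1 M1) =
    Config off.+1 R1 M1.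
  have -> : (off + (size b + 4)) = off + (size b + 3 + 1) by lia.
  by rewrite HP ?nthE //; lia.
have szE : off + size (cfor x lim body off) = (off + (size b + 5)).
  by rewrite /cfor -/b /= size_cat /=; lia.
(* Induction on the number [k] of remaining rounds, starting at the test rather than at the
   initialization. *)
have loop k j (R1 M1 : nat -> nat) : j + k = N -> R1 x = j -> R1 lim = N -> I j R1 M1 ->
    exists t' R' M', [/\ t' <= k * (t + 3) + 2,
      iter t' (step w P) (Config off.+1 R1 M1)
        = Config (off + (size b + 5)) R' M' & I N R' M'].
  elim: k j R1 M1 => [|k IH] j R1 M1 hj hRx hRl hI.
    exists 2, R1, M1; rewrite iterSr H2 hRx hRl ifN ?H3 /=; last by lia.
    by split => //; rewrite -hj addn0.
  have jN : j < N by lia.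
  have := hbody j R1 M1 jN hRx hRl hI (pre ++ [:: SetC x 0; JumpLt x lim off.+3;
      Jump (off + (size b + 5))]) ([:: Plus x x 1; Jump off.+1] ++ post).
  have -> : size (pre ++ [:: SetC x 0; JumpLt x lim off.+3;
      Jump (off + (size b + 5))]) = off.+3 by rewrite size_cat addn3.
  rewrite -/b; have -> : (pre ++ [:: SetC x 0; JumpLt x lim off.+3; Jump (off + (size b + 5))])
      ++ b ++ [:: Plus x x 1; Jump off.+1] ++ post = P.
    by rewrite /P /cfor -/off -/b -!catA.
  move=> -[u [R2 [M2 [hu e [h2x h2l h21 h2I]]]]].
  have [||||v [R' [M' [hv e' q]]]] := IH j.+1 (upd R2 x j.+1) M2.
  - by lia.
  - by rewrite upd_eq.
  - by rewrite upd_neq // eq_sym.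
  - by [].
  exists (v + (u + 1).+2), R', M'; split => //; first by nia.
  rewrite iterD !iterS iterD /= H2 hRx hRl jN e H4 // H5 h2x.
  by rewrite addn1 modn_small // (leq_ltn_trans jN).
have [||||u [R' [M' [hu e q]]]] := loop N 0 (upd R x 0) M.
- by [].
- by rewrite upd_eq.
- by rewrite upd_neq // eq_sym.
- by [].
exists u.+1, R', M'; split => //; first by lia.
by rewrite iterSr H1 szE.
Qed.

Definition cwhen_lt (a b : nat) (c : code) : code := fun off =>
  let s := c off.+2 in
  [:: JumpLt a b off.+2; Jump (off + size s).+2] ++ s.

Lemma wp_when_lt a b c t R M Q :
  (R a < R b -> wp w c t R M Q) -> (R b <= R a -> Q R M) ->
  wp w (cwhen_lt a b c) (t + 2) R M Q.
Proof.
move=> h1 h2 pre post; rewrite /cwhen_lt.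
set off := size pre; set s := c off.+2; set P := pre ++ _.
have H1 : step w P (Config off R M) =
    Config (if R a < R b then off.+2 else off.+1) R M.
  by rewrite /P -[X in Config X R M]addn0 step_at // addn0.
have H2 : step w P (Config off.+1 R M) = Config (off + size s).+2 R M.
  by rewrite /P -[off.+1]addn1 step_at.
have szE : off + size ([:: JumpLt a b off.+2; Jump (off + size s).+2] ++ s)
    = (off + size s).+2 by rewrite size_cat /=; lia.
rewrite szE; case: (ltnP (R a) (R b)) => hab; last first.
  exists 2, R, M; split; [by lia| |exact: h2].
  by rewrite iterSr H1 ltnNge hab /= H2.
have := h1 hab (pre ++ [:: JumpLt a b off.+2; Jump (off + size s).+2]) post.
have -> : size (pre ++ [:: JumpLt a b off.+2; Jump (off + size s).+2]) = off.+2.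
  by rewrite size_cat addn2.
rewrite -/s -catA => -[u [R' [M' [hu e q]]]].
exists u.+1, R', M'; split => //; first by lia.
by rewrite iterSr H1 hab /P -catA /= e.
Qed.

(** Unrolled in the program text: used for lists fixed by the vocabulary and the formula (relations,
    types, positions), whereas loops over objects and records use [cfor]. *)
Definition cseqs (T : Type) (s : seq T) (c : T -> code) : code :=
  foldr (fun x => cseq (c x)) (block [::]) s.

Lemma wp_seqs (T : Type) (s : seq T) (c : T -> code) t
    (I : seq T -> _ -> _ -> Prop) R M :
  (forall s1 x s2 R M, s = s1 ++ x :: s2 -> I s1 R M ->
     wp w (c x) t R M (I (rcons s1 x))) ->
  I [::] R M -> wp w (cseqs s c) (size s * t) R M (I s).
Proof.
move=> hc; suff gen s2 s1 R1 M1 : s = s1 ++ s2 -> I s1 R1 M1 ->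
  wp w (cseqs s2 c) (size s2 * t) R1 M1 (I s) by apply: (gen s [::]).
elim: s2 s1 R1 M1 => [|x s2 IH] s1 R1 M1 sE h.
  by apply: (@wp_block [::]) => //; apply: sp_nil; rewrite sE cats0.
rewrite /= mulSn; apply: wp_seq; apply: wp_mono (hc _ _ _ _ _ sE h) _ _ => //.
by move=> R' M'; apply: IH; rewrite cat_rcons.
Qed.

Lemma wpE c t R M Q : wp w c t R M Q ->
  exists t' R' M', [/\ t' <= t,
    iter t' (step w (c 0)) (Config 0 R M) = Config (size (c 0)) R' M' & Q R' M'].
Proof. by move=> /(_ [::] [::]) /=; rewrite cats0. Qed.

End ProgramLogic.

Arguments sp_nil {w R M Q}.

Global Opaque sp wp.

(** * Row-major indices *)

Definition idx (n : nat) (s : seq nat) : nat := foldl (fun a o => a * n + o) 0 s.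

Lemma idx_lt n s : all (fun x => x < n) s -> idx n s < n ^ size s.
Proof.
elim/last_ind: s => [|s x IH]; first by rewrite expn0.
rewrite all_rcons /idx foldl_rcons size_rcons expnSr -/(idx n s).
by move=> /andP [hx /IH]; nia.
Qed.

(** The last digit is the residue modulo [n], and the rest follows by induction. Equal lengths
    matter because leading zeros do not change the index. *)
Lemma idx_inj n s s' :
  size s = size s' -> all (fun x => x < n) s -> all (fun x => x < n) s' ->
  idx n s = idx n s' -> s = s'.
Proof.
elim/last_ind: s s' => [|s x IH] s'; first by case: s'.
case/lastP: s' => [|s' x']; rewrite ?size_rcons // => -[hs].
rewrite !all_rcons /idx !foldl_rcons -!/(idx n _) => /andP [hx ha] /andP [hx' ha'] e.
have n_gt0 : 0 < n by lia.
have ex : x = x'.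
  by have := congr1 (modn^~ n) e; rewrite !modnMDl !modn_small.
have : idx n s = idx n s' by move: e; rewrite ex; nia.
by move=> /(IH _ hs ha ha') ->; rewrite ex.
Qed.

Lemma tuple_indexE n k (x : k.-tuple 'I_n) :
  tuple_index x = idx n [seq val o | o <- x].
Proof. by rewrite /tuple_index /idx; elim: (tval x) 0 => //=. Qed.

Lemma all_val_lt n m (x : m.-tuple 'I_n) :
  all (fun a => a < n) [seq val o | o <- x].
Proof. by rewrite all_map; apply/allP => o _ /=. Qed.

Lemma idx_tuple_lt n m (x : m.-tuple 'I_n) : idx n [seq val o | o <- x] < n ^ m.
Proof. by have := idx_lt (all_val_lt x); rewrite size_map size_tuple. Qed.

Lemma idx_tuple_inj n m (x y : m.-tuple 'I_n) :
  idx n [seq val o | o <- x] = idx n [seq val o | o <- y] -> x = y.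
Proof.
move=> h; apply/val_inj/(inj_map val_inj).
by apply: (@idx_inj n) => //; rewrite ?size_map ?size_tuple ?all_val_lt.
Qed.

(** * The program *)

Section Program.
Variables (r : nat) (ar : 'I_r -> nat) (k l : nat).
Hypothesis q_gt0 : 0 < k + l.

(* Register 1 holds 1, register 2 holds the number n of objects, [rbase j]
   the start of the j-th array, [rstart i] and [rcnt i] the position and the
   number of the records of relation i.  A fragment placed at stack depth d only
   modifies the registers from d on. *)
Definition rbase (j : nat) : nat := 3 + j.
Definition rstart (i : nat) : nat := r + 6 + i.
Definition rcnt (i : nat) : nat := 2 * r + 6 + i.
Definition depth0 : nat := 3 * r + 6.

Definition cidx (d : nat) (xs : seq nat) : seq instr :=
  SetC d 0 :: flatten [seq [:: Times d d 2; Plus d d x] | x <- xs].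

Definition caddr (d j : nat) (xs : seq nat) : seq instr :=
  cidx d xs ++ [:: Plus d d (rbase j)].

(** Register [p + 1] is skipped because it is the record counter of [crecords]. The pointer in [p]
    is left at the next record. *)
Definition cload (p m : nat) : seq instr :=
  flatten [seq [:: Read (p + 2 + a) p; Plus p p 1] | a <- iota 0 m].

(** Truth values are the numbers 0 and 1, so the code is free of branches: negation is 1 - a,
    conjunction ab, disjunction a + b - ab. *)
Fixpoint ceval (Z d : nat) (f : qformula ar (k + l)) : seq instr :=
  match f with
  | Atom i v => caddr d i [seq Z + nat_of_ord o | o <- tval v] ++ [:: Read d d]
  | Neg g => ceval Z d g ++ [:: Minus d 1 d]
  | Conj g h => ceval Z d g ++ ceval Z d.+1 h ++ [:: Times d d d.+1]
  | Disj g h => ceval Z d g ++ ceval Z d.+1 h ++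
      [:: Times d.+2 d d.+1; Plus d d d.+1; Minus d d d.+2]
  end.

Definition nest (Z : nat) (vs : seq 'I_(k + l)) (body : code) : code :=
  foldr (fun (v : 'I_(k + l)) c => cfor (Z + v) 2 c) body vs.

Definition crecords (d : nat) (i : 'I_r) (body : code) : code :=
  cseq (block [:: SetC d 0; Plus d d (rstart i)])
    (cfor d.+1 (rcnt i) (cseq (block (cload d (ar i))) body)).

Arguments cidx : simpl never.
Arguments caddr : simpl never.
Arguments cload : simpl never.

Lemma straight_cidx d xs : all is_straight (cidx d xs).
Proof. by rewrite /cidx; elim: xs. Qed.

Lemma straight_caddr d j xs : all is_straight (caddr d j xs).
Proof. by rewrite all_cat straight_cidx. Qed.

Lemma straight_cload p m : all is_straight (cload p m).
Proof. by rewrite /cload; elim: (iota 0 m). Qed.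

Lemma straight_ceval Z d f : all is_straight (ceval Z d f).
Proof.
elim: f d => [i v|g IH|g IHg h IHh|g IHg h IHh] d /=.
- by rewrite !all_cat; elim: [seq _ | _ <- v].
- by rewrite all_cat IH.
- by rewrite !all_cat IHg IHh.
- by rewrite !all_cat IHg IHh.
Qed.

(** * Splitting off the last variable: mixed atoms and types *)

Definition last_var : 'I_(k + l).
Proof. by exists (k + l).-1; rewrite prednK. Defined.

Variable phi : qformula ar (k + l).

Fixpoint map_atoms (g : forall i, (ar i).-tuple 'I_(k + l) -> qformula ar (k + l))
    (f : qformula ar (k + l)) : qformula ar (k + l) :=
  match f with
  | Atom i v => g i v
  | Neg f1 => Neg (map_atoms g f1)
  | Conj f1 f2 => Conj (map_atoms g f1) (map_atoms g f2)
  | Disj f1 f2 => Disj (map_atoms g f1) (map_atoms g f2)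
  end.

Definition mixed (i : 'I_r) (v : (ar i).-tuple 'I_(k + l)) : bool :=
  (last_var \in v) && ~~ all (pred1 last_var) v.

(** The syntax has no truth constants; [phi] serves as the formula from which a tautology and a
    contradiction are built. *)
Definition const_form (b : bool) : qformula ar (k + l) :=
  if b then Disj phi (Neg phi) else Conj phi (Neg phi).

(* The formula phi0. *)
Definition unmixed : qformula ar (k + l) :=
  map_atoms (fun i v => if mixed v then const_form false else Atom v) phi.

(* phi0 for a last variable whose value a satisfies R_i(a, ..., a) exactly when
   [tau i]. *)
Definition unmixed_at (tau : {ffun 'I_r -> bool}) : qformula ar (k + l) :=
  map_atoms (fun i v => if mixed v then const_form false
                        else if last_var \in v then const_form (tau i)
                        else Atom v) phi.

Definition has_type (tau : {ffun 'I_r -> bool}) : qformula ar (k + l) :=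
  foldr (fun i => Conj (let f := Atom (nseq_tuple (ar i) last_var) in
                        if tau i then f else Neg f))
    (const_form true) (enum 'I_r).

Definition env_regs (Z : nat) : seq nat := [seq Z + i | i <- iota 0 (k + l)].
Definition head_regs (Z : nat) : seq nat := [seq Z + i | i <- iota 0 k].

(** Variables that a loop nest does not enumerate still need legal values, since [const_form] makes
    the machine evaluate [phi] on all variables. *)
Definition czero (Z : nat) : code := block [seq SetC x 0 | x <- env_regs Z].

Definition centry (i : 'I_r) : seq instr :=
  let d := depth0 + 2 + ar i in
  caddr d i [seq depth0 + 2 + a | a <- iota 0 (ar i)] ++ [:: Write d 1].

Definition ctable (i : 'I_r) : code := crecords depth0 i (block (centry i)).

Definition ccount (Z : nat) (f : qformula ar (k + l)) : seq instr :=
  let d := Z + (k + l) in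
  ceval Z d f ++
  [:: Read d.+1 (rbase r.+2); Plus d d d.+1; Write (rbase r.+2) d].

Definition cadd (Z : nat) (f : qformula ar (k + l)) : seq instr :=
  let d := Z + (k + l) in
  ceval Z d f ++ [:: Read d.+1 (rbase r.+2); Times d d d.+1] ++
  caddr d.+1 r.+1 (head_regs Z) ++
  [:: Read d.+2 d.+1; Plus d d d.+2; Write d.+1 d].

Definition vars_but_last : seq 'I_(k + l) :=
  [seq v <- enum 'I_(k + l) | v != last_var].

Definition ctype (tau : {ffun 'I_r -> bool}) : code :=
  cseq (block [:: SetC depth0 0; Write (rbase r.+2) depth0])
  (cseq (czero depth0)
  (cseq (nest depth0 [:: last_var] (block (ccount depth0 (has_type tau))))
  (cseq (czero depth0)
    (nest depth0 vars_but_last (block (cadd depth0 (unmixed_at tau))))))).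

(** Register [d] holds the address of the mark and [d.+1] its complement. Multiplying phi and phi0
    by this complement cancels the correction of an assignment that is already marked, without a
    branch. *)
Definition ccorrect (Z : nat) : seq instr :=
  let d := Z + (k + l) in
  caddr d r (env_regs Z) ++ [:: Read d.+1 d; Minus d.+1 1 d.+1] ++
  ceval Z (d + 2) phi ++ [:: Times (d + 2) (d + 2) d.+1] ++
  ceval Z (d + 3) unmixed ++ [:: Times (d + 3) (d + 3) d.+1] ++
  caddr (d + 4) r.+1 (head_regs Z) ++
  [:: Read (d + 5) (d + 4); Plus (d + 5) (d + 5) (d + 2);
      Minus (d + 5) (d + 5) (d + 3); Write (d + 4) (d + 5); Write d 1].

(** In [(a, b, j)], entry [a] of a record of relation [i] becomes the value of variable [j], and
    entry [b] that of the last variable. *)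
Definition position : finType :=
  {i : 'I_r & ('I_(ar i) * 'I_(ar i) * 'I_(k + l))%type}.

Definition cmixed (p : position) : code :=
  let: existT i (a, b, j) := p in
  let Z := depth0 + 2 + ar i in
  crecords depth0 i
    (cseq (block [:: SetC (Z + j) 0; Plus (Z + j) (Z + j) (depth0 + 2 + a);
                     SetC (Z + last_var) 0;
                     Plus (Z + last_var) (Z + last_var) (depth0 + 2 + b)])
          (nest Z [seq v <- vars_but_last | v != j] (block (ccorrect Z)))).

Definition positions : seq position :=
  [seq p <- enum {: position} | (tagged p).2 != last_var].

(** Register [depth0] is a pointer that walks through the input and ends just behind it, where the
    first array starts; [depth0.+1] then receives the common array length. *)
Definition csetup : code :=
  cseq (block [:: SetC 1 1; SetC 2 0; Read 2 2; SetC depth0 1])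
  (cseq (cseqs (enum 'I_r) (fun i : 'I_r =>
     block [:: Read (rcnt i) depth0; Plus depth0 depth0 1; SetC (rstart i) 0;
               Plus (rstart i) (rstart i) depth0; SetC depth0.+1 (ar i);
               Times depth0.+1 depth0.+1 (rcnt i);
               Plus depth0 depth0 depth0.+1]))
  (cseq (block [:: SetC depth0.+1 1])
  (cseq (cseqs (iota 0 (k + l + \sum_(i < r) ar i))
           (fun=> block [:: Times depth0.+1 depth0.+1 2]))
  (cseq (block [:: SetC (rbase 0) 0; Plus (rbase 0) (rbase 0) depth0])
    (cseqs (iota 0 (r + 2))
       (fun j => block [:: Plus (rbase j.+1) (rbase j) depth0.+1])))))).

Definition cvalues : code :=
  cseq csetup
  (cseq (cseqs (enum 'I_r) ctable)
  (cseq (cseqs (enum {: {ffun 'I_r -> bool}}) ctype)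
    (cseqs positions cmixed))).

Definition cout_values : code := block [:: SetC 0 0; Plus 0 0 (rbase r.+1)].

Definition cbetter (dir : direction) (Z : nat) : code :=
  let d := Z + (k + l) in
  cseq (block (caddr d r.+1 (head_regs Z) ++
               [:: Read d.+1 d; Read d.+2 (rbase r.+2)]))
    (match dir with Max => cwhen_lt d.+2 d.+1 | Min => cwhen_lt d.+1 d.+2 end
       (block [:: Write (rbase r.+2) d.+1])).

Definition cout_optimum (dir : direction) : code :=
  cseq (block [:: Read depth0 (rbase r.+1); Write (rbase r.+2) depth0])
  (cseq (czero depth0)
  (cseq (nest depth0 [seq lshift l i | i <- enum 'I_k] (cbetter dir depth0))
    (block [:: Read 0 (rbase r.+2)]))).

(** * Memory layout; execution of the address, load and evaluation fragments *)

Section Machine.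
Variables (S : structure ar) (w : nat).
Let n := nobj S.
(** One length for all arrays: the exponent dominates [k], [k + l] and every arity, so any index in
    use fits. *)
Definition region : nat := n ^ (k + l + \sum_(i < r) ar i).
Definition insize : nat := size (encode S).
Definition cell (j x : nat) : nat := insize + j * region + x.
Hypothesis word_mem : insize + (r + 3) * region <= 2 ^ w.
Hypothesis word_ar : forall i, ar i < 2 ^ w.

Lemma n_gt0 : 0 < n. Proof. exact: nobj_gt0. Qed.

Lemma region_gt0 : 0 < region.
Proof. by rewrite expn_gt0 n_gt0. Qed.

Lemma exp_le_region m : m <= k + l + \sum_(i < r) ar i -> n ^ m <= region.
Proof. by move=> hm; rewrite leq_pexp2l // n_gt0. Qed.

Lemma ar_le i : ar i <= k + l + \sum_(i < r) ar i.
Proof. by rewrite (bigD1 i) //=; lia. Qed.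

Lemma insize_gt0 : 0 < insize.
Proof. by rewrite /insize /encode. Qed.

Lemma word_gt3 : 3 < 2 ^ w.
Proof. by have := region_gt0; have := insize_gt0; nia. Qed.

Lemma region_lt : region < 2 ^ w.
Proof. by have := insize_gt0; nia. Qed.

Lemma n_le_region : n <= region.
Proof. by rewrite -[n]expn1; apply: exp_le_region; lia. Qed.

Lemma cell_lt j x : j < r + 3 -> x < region -> cell j x < 2 ^ w.
Proof. by rewrite /cell; nia. Qed.

(** Offsets stay below [region], so Euclidean division by it recovers the array and the offset:
    distinct entries never share an address. *)
Lemma cell_inj j x j' x' : x < region -> x' < region ->
  cell j x = cell j' x' -> j = j' /\ x = x'.
Proof.
rewrite /cell -!addnA => hx hx' /addnI e.
have ej : j = j'.
  have := congr1 (divn^~ region) e.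
  by rewrite !divnMDl ?region_gt0 // !divn_small // !addn0.
by split => //; move: e; rewrite ej => /addnI.
Qed.

(** The last clause speaks of the input word sequence and not of the memory, so that [glob] is a
    property of registers alone; [reads_input] supplies the link. *)
Definition glob (R : nat -> nat) : Prop :=
  [/\ R 1 = 1, R 2 = n, forall j, j < r + 3 -> R (rbase j) = cell j 0,
      forall i : 'I_r, R (rcnt i) = size (records S i)
    & forall i : 'I_r, R (rstart i) + size (records S i) * ar i <= insize /\
        forall t (a : 'I_(ar i)) rho0, t < size (records S i) ->
          nth 0 (encode S) (R (rstart i) + t * ar i + a)
          = tnth (nth rho0 (records S i) t) a].

Lemma glob_agree R R' : agree_below depth0 R R' -> glob R -> glob R'.
Proof.
move=> h [h1 h2 h3 h4 h5]; rewrite /depth0 in h; split.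
- by rewrite h //; lia.
- by rewrite h //; lia.
- by move=> j hj; rewrite h ?h3 // /rbase; lia.
- by move=> i; rewrite h ?h4 // /rcnt; have := ltn_ord i; lia.
- by move=> i; rewrite h ?h5 // /rstart; have := ltn_ord i; lia.
Qed.

Lemma sp_cidx d xs s R M Q :
  2 < d -> R 2 = n -> all (fun x => x < d) xs ->
  all (fun x => x < n) [seq R x | x <- xs] ->
  n ^ size xs <= 2 ^ w ->
  (forall R', agree_below d R R' -> R' d = idx n [seq R x | x <- xs] ->
     sp w s R' M Q) ->
  sp w (cidx d xs ++ s) R M Q.
Proof.
move=> hd h2 hxs hR hw hs; apply: sp_set; first by have := word_gt3; lia.
(* If [a] is the index of the digits read so far, every completion has an index below
   [(a + 1) * n ^ size xs]; this excludes overflow at each Horner step. *)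
suff gen a R1 : (a + 1) * n ^ size xs <= 2 ^ w -> agree_below d R R1 ->
    R1 d = a -> (forall R', agree_below d R R' ->
      R' d = foldl (fun a o => a * n + o) a [seq R x | x <- xs] ->
      sp w s R' M Q) ->
    sp w (flatten [seq [:: Times d d 2; Plus d d x] | x <- xs] ++ s) R1 M Q.
  apply: (gen 0) => //; first by rewrite mul1n.
    exact: agree_below_upd.
  by rewrite upd_eq.
elim: xs a R1 hxs hR {hw hs} => [|x xs IH] a R1.
  by move=> _ _ _ hR1 ha hs; apply: hs.
rewrite [all _ _]/= [all _ (map _ _)]/= [size _]/= [map _ _]/= [map (fun=> _) _]/=.
move=> /andP [hx hxs] /andP [hRx hR]; rewrite expnS => hw hR1 ha hs.
have hn : 0 < n ^ size xs by rewrite expn_gt0 n_gt0.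
have hlt : a * n + R x < 2 ^ w.
  apply: leq_trans hw; apply: (@leq_trans ((a + 1) * n)); first by lia.
  by rewrite leq_mul2l leq_pmulr ?orbT.
apply: sp_times; first by rewrite ha hR1 // h2; lia.
rewrite ha hR1 // h2.
have e x' : x' < d -> upd R1 d (a * n) x' = R x' by move=> ?; rewrite upd_neq ?hR1; lia.
apply: sp_plus; rewrite upd_eq e //.
apply: (IH (a * n + R x)) => //; first by apply: leq_trans hw; rewrite mulnA leq_mul2r; apply/orP; right; lia.
  by apply: agree_below_upd => //; apply: agree_below_upd.
by rewrite upd_eq.
Qed.

Lemma sp_caddr d j xs s R M Q :
  depth0 <= d -> j < r + 3 -> glob R -> all (fun x => x < d) xs ->
  all (fun x => x < n) [seq R x | x <- xs] ->
  n ^ size xs <= region ->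
  (forall R', agree_below d R R' ->
     R' d = cell j (idx n [seq R x | x <- xs]) -> sp w s R' M Q) ->
  sp w (caddr d j xs ++ s) R M Q.
Proof.
rewrite /depth0 => hd hj hg hxs hR hn hs; rewrite -catA.
have [_ h2 h3 _ _] := hg.
apply: sp_cidx => //; first by lia.
  by apply: leq_trans hn _; have := region_lt; lia.
move=> R' hR' eR'; have := idx_lt hR; rewrite size_map => hi.
have e : R' d + R' (rbase j) = cell j (idx n [seq R x | x <- xs]).
  by rewrite eR' hR' ?h3 // /cell /rbase; lia.
apply: sp_plus; first by rewrite e cell_lt //; lia.
apply: hs; first exact: agree_below_upd.
by rewrite e upd_eq.
Qed.

Lemma sp_cload p m s R M Q :
  1 < p -> R 1 = 1 -> R p + m < 2 ^ w ->
  (forall R', (forall x, x < p + 2 -> x != p -> R' x = R x) ->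
     R' p = R p + m -> (forall a, a < m -> R' (p + 2 + a) = M (R p + a)) ->
     sp w s R' M Q) ->
  sp w (cload p m ++ s) R M Q.
Proof.
move=> hp h1; elim: m s => [|m IH] s hm hs.
  by apply: hs => //; rewrite addn0.
rewrite /cload -(addn1 m) iotaD map_cat flatten_cat -catA.
apply: IH; first by lia.
move=> R' h2 h3 h4 /=; apply: sp_read.
have hne : p != p + 2 + m by lia.
have e1 v : upd R' (p + 2 + m) v 1 = 1 by rewrite upd_neq ?h2 //; lia.
apply: sp_plus; rewrite e1 upd_neq // h3; first by lia.
apply: hs.
- by move=> x hx hxp; rewrite !upd_neq ?h2 //; lia.
- by rewrite upd_eq; lia.
move=> a ha; rewrite upd_neq; last by lia.
case: (ltngtP a m) => ham; [|by lia|].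
  by rewrite upd_neq ?h4 //; lia.
by rewrite ham upd_eq.
Qed.

Notation env := ((k + l).-tuple 'I_n).

Definition holds_env (R : nat -> nat) (Z : nat) (e : env) : Prop :=
  forall o : 'I_(k + l), R (Z + o) = tnth e o.

Lemma holds_env_agree R R' Z d e :
  agree_below d R R' -> Z + (k + l) <= d -> holds_env R Z e -> holds_env R' Z e.
Proof. by move=> h hd he o; rewrite h ?he //; have := ltn_ord o; lia. Qed.

Definition tables (M : nat -> nat) : Prop :=
  forall i (rho : (ar i).-tuple 'I_n),
    M (cell i (idx n [seq val o | o <- rho])) = (rho \in records S i).

Lemma sp_ceval f Z d s R M Q e :
  depth0 <= Z -> Z + (k + l) <= d -> glob R -> holds_env R Z e -> tables M ->
  (forall R', agree_below d R R' -> R' d = holds e f -> sp w s R' M Q) ->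
  sp w (ceval Z d f ++ s) R M Q.
Proof.
move=> hZ hd hg he hM; have hw := word_gt3.
have glob' d' R1 : depth0 <= d' -> agree_below d' R R1 -> glob R1.
  by move=> ? hR1; apply: glob_agree hg; apply: agree_below_leq hR1.
elim: f d s R hd hg he glob'
  => [i v|g IH|g IHg h IHh|g IHg h IHh] d s R hd hg he glob' hs /=.
- rewrite -catA; have vE : [seq R x | x <- [seq Z + nat_of_ord o | o <- tval v]]
      = [seq val o | o <- map_tuple (tnth e) v].
    by rewrite -!map_comp; apply: eq_map => o /=; rewrite he.
  apply: sp_caddr => //; try lia.
  + by have := ltn_ord i; lia.
  + by rewrite all_map; apply/allP => o _ /=; have := ltn_ord o; lia.
  + by rewrite vE all_val_lt.
  + by rewrite size_map size_tuple exp_le_region // ar_le.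
  move=> R'; rewrite vE => hR' eR'; apply: sp_read; apply: hs.
    exact: agree_below_upd.
  by rewrite upd_eq eR' hM.
- rewrite -catA; apply: IH => // R' hR' eR'.
  have [h1 _ _ _ _] : glob R' by apply: glob' hR'; lia.
  apply: sp_minus; rewrite ?h1 ?eR'; [by case: holds|by lia|].
  apply: hs; first exact: agree_below_upd.
  by rewrite upd_eq /=; case: holds.
- rewrite -!catA; apply: IHg => // R1 hR1 eR1.
  have g1 : glob R1 by apply: glob' hR1; lia.
  apply: IHh => //; first by lia.
  + exact: holds_env_agree hR1 hd he.
  + by move=> d' R2 hd' h'; apply: glob_agree g1; apply: agree_below_leq h'.
  move=> R2 hR2 eR2.
  have e2 : R2 d = R1 d by rewrite hR2 //.
  apply: sp_times; rewrite e2 eR1 eR2; first by case: holds; case: holds; lia.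
  apply: hs; last by rewrite upd_eq /=; case: holds; case: holds.
  apply: agree_below_upd => //; apply: agree_below_trans hR1 _.
  by apply: agree_below_leq hR2; lia.
- rewrite -!catA; apply: IHg => // R1 hR1 eR1.
  have g1 : glob R1 by apply: glob' hR1; lia.
  apply: IHh => //; first by lia.
  + exact: holds_env_agree hR1 hd he.
  + by move=> d' R2 hd' h'; apply: glob_agree g1; apply: agree_below_leq h'.
  move=> R2 hR2 eR2.
  have e2 : R2 d = R1 d by rewrite hR2 //.
  apply: sp_times; rewrite e2 eR1 eR2; first by case: holds; case: holds; lia.
  have hd2 : d != d.+2 by lia.
  have hd1 : d.+1 != d.+2 by lia.
  apply: sp_plus; rewrite !upd_neq // e2 eR1 eR2.
    by case: holds; case: holds; lia.
  apply: sp_minus; rewrite ?upd_eq ?(@upd_neq _ d) ?upd_eq; try lia;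
    try by case: holds; case: holds; lia.
  apply: hs; last by rewrite upd_eq /=; case: holds; case: holds.
  apply: agree_below_upd => //; apply: agree_below_upd => //.
  apply: agree_below_upd; last by lia.
  by apply: agree_below_trans hR1 _; apply: agree_below_leq hR2; lia.
Qed.

(** * Loops over assignments and records *)

Definition set_var (e : env) (v : 'I_(k + l)) (a : 'I_n) : env :=
  [tuple if o == v then a else tnth e o | o < k + l].

(** The assignments in the order in which [nest] visits them; variables outside [vs] keep their
    value in [e]. *)
Fixpoint env_list (vs : seq 'I_(k + l)) (e : env) : seq env :=
  if vs is v :: vs' then
    flatten [seq env_list vs' (set_var e v a) | a <- enum 'I_n]
  else [:: e].

Fixpoint nest_cost (t : nat) (vs : seq 'I_(k + l)) : nat :=
  if vs is v :: vs' then n * (nest_cost t vs' + 3) + 3 else t.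

(** Indexing the invariant by the list of visited assignments turns the effect of a nest into a sum
    or a union over [env_list]. The list [done] is general so that an inner nest can continue the
    list of the outer one. *)
Lemma wp_nest Z body t R0 (I : seq env -> (nat -> nat) -> Prop) :
  depth0 <= Z -> glob R0 ->
  (forall done e R M, agree_below Z R0 R -> holds_env R Z e -> I done M ->
     wp w body t R M (fun R' M' =>
       agree_below (Z + (k + l)) R R' /\ I (rcons done e) M')) ->
  forall vs (e : env) done R M, uniq vs -> agree_below Z R0 R ->
    (forall o : 'I_(k + l), o \notin vs -> R (Z + o) = tnth e o) ->
    I done M ->
    wp w (nest Z vs body) (nest_cost t vs) R M (fun R' M' =>
      (forall x, x < Z + (k + l) -> x \notin [seq Z + nat_of_ord v | v <- vs] ->
         R' x = R x) /\ I (done ++ env_list vs e) M').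
Proof.
move=> hZ hg hbody; have [h1 h2 _ _ _] := hg.
elim=> [|v vs IH] e done R M /=.
  move=> _ hR he hI; apply: wp_mono (hbody done e R M hR _ hI) _ _ => //.
    by move=> o; apply: he.
  by move=> R' M' [h hI']; split=> [x hx _|]; [apply: h|rewrite cats1].
move=> /andP [vvs uvs] hR he hI.
have hv : v < k + l by [].
have nv x : x < Z -> x \notin [seq Z + nat_of_ord v | v <- v :: vs].
  by move=> hx; apply/mapP => -[u _ e']; lia.
(* After [j] rounds of the outermost loop, the sublists for the first [j] values of [v] have been
   appended to [done]. *)
pose J j (R1 M1 : nat -> nat) := (forall x, x < Z + (k + l) ->
    x \notin [seq Z + nat_of_ord v | v <- v :: vs] -> R1 x = R x) /\
  I (done ++ flatten [seq env_list vs (set_var e v a) | a <- take j (enum 'I_n)]) M1.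
rewrite /depth0 in hZ.
apply: wp_mono (@wp_for w (Z + v) 2 _ (nest_cost t vs) n J R M _ _ _ _ _) _ _.
- by lia.
- by rewrite hR; lia.
- by apply: leq_ltn_trans n_le_region region_lt.
- move=> j R1 M1 hj hRj hRn [hR1 hI1].
  have hR01 : agree_below Z R0 R1.
    by move=> x hx; rewrite hR1 ?hR ?nv //; lia.
  apply: wp_mono (IH (set_var e v (Ordinal hj)) _ R1 M1 uvs hR01 _ hI1) _ _ => //.
    move=> o ho; rewrite tnth_mktuple; case: eqP => [->|/eqP hov]; first exact: hRj.
    rewrite hR1 ?he //; first by rewrite inE negb_or hov.
      by have := ltn_ord o; lia.
    apply/mapP => -[u]; rewrite inE => hu /addnI /val_inj ou.
    by move: hu; rewrite -ou (negPf hov) (negPf ho).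
  move=> R' M' [h hI']; split.
  + rewrite h ?hRj //; first by lia.
    apply/mapP => -[u hu /addnI /val_inj vu].
    by move: vvs; rewrite vu hu.
  + by rewrite h ?hRn //; [lia|apply/mapP => -[u _ e']; lia].
  + rewrite h ?hR01 ?h1 //; [lia|lia|apply/mapP => -[u _ e']; lia].
  split.
    move=> x hx hxn; rewrite upd_neq; last by move: hxn; rewrite inE; case: eqP.
    by rewrite h ?hR1 //; move: hxn; rewrite inE negb_or => /andP [].
  rewrite (take_nth (Ordinal hj)) ?size_enum_ord // map_rcons flatten_rcons.
  by rewrite (nth_ord_enum (Ordinal hj) (Ordinal hj)) catA.
- split=> [x hx hxn|]; last by rewrite take0 cats0.
  by rewrite upd_neq //; move: hxn; rewrite inE; case: eqP.
- by [].
move=> R' M' [h hI']; split => //.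
by move: hI'; rewrite take_oversize ?size_enum_ord.
Qed.

Lemma size_cload p m : size (cload p m) = 2 * m.
Proof.
rewrite /cload -[in RHS](size_iota 0 m).
by elim: (iota 0 m) => //= a s ->; rewrite mulnS.
Qed.

Definition reads_input (M : nat -> nat) : Prop :=
  forall a, a < insize -> M a = nth 0 (encode S) a.

(** Records do not repeat, so there are at most [n ^ ar i] of them; record counts therefore fit into
    a word. *)
Lemma size_records_le i : size (records S i) <= region.
Proof.
apply: leq_trans (exp_le_region (ar_le i)).
rewrite -(card_uniqP (records_uniq S i)) (leq_trans (max_card _)) //.
by rewrite card_tuple card_ord.
Qed.

Lemma size_records_lt i : size (records S i) < 2 ^ w.
Proof. exact: leq_ltn_trans (size_records_le i) region_lt. Qed.

(** The cost per record is two instructions per loaded entry, the body and the loop overhead. The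
    body must leave pointer, counter and loaded record alone, and the invariant must protect the
    input, from which later records are still read. *)
Lemma wp_crecords d i body t R0 (I : nat -> (nat -> nat) -> Prop) M0 :
  depth0 <= d -> glob R0 ->
  (forall j M, I j M -> reads_input M) ->
  (forall j rho0 R M, j < size (records S i) -> agree_below d R0 R ->
     (forall a : 'I_(ar i),
        R (d + 2 + a) = tnth (nth rho0 (records S i) j) a) ->
     I j M -> wp w body t R M (fun R' M' =>
       agree_below (d + 2 + ar i) R R' /\ I j.+1 M')) ->
  I 0 M0 ->
  wp w (crecords d i body) (2 + (size (records S i) * (2 * ar i + t + 3) + 3))
    R0 M0 (fun R' M' => agree_below d R0 R' /\ I (size (records S i)) M').
Proof.
move=> hd hg hread hbody hI; have [h1 h2 _ h4 h5] := hg.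
have hw := word_gt3; have [hstart hinp] := h5 i.
have hi := ltn_ord i; rewrite /depth0 in hd.
have hws : insize < 2 ^ w by have := region_gt0; nia.
have reg_lt_d : rstart i < d /\ rcnt i < d by rewrite /rstart /rcnt; lia.
apply: wp_seq; apply: wp_block => //.
refine (sp_set _ _); first by lia.
refine (sp_plus _ _); rewrite upd_eq upd_neq; try lia.
refine (sp_nil _); rewrite add0n.
set R1 := upd _ _ _.
have hR1 : agree_below d R0 R1 by do 2! [apply: agree_below_upd => //].
pose J j (R M : nat -> nat) :=
  [/\ agree_below d R0 R, R d = R0 (rstart i) + j * ar i & I j M].
have hcnt := size_records_lt i.
apply: wp_mono (@wp_for w d.+1 (rcnt i) _ (2 * ar i + t) _ J R1 M0 _ _ hcnt _ _) _ _ => //.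
- by lia.
- by rewrite hR1 ?h4 //; lia.
- move=> j R M hj hRj hRn [hR hRd hIj].
  rewrite -(size_cload d); apply: wp_seq; apply: wp_block.
    exact: straight_cload.
  rewrite -[cload _ _]cats0.
  have hj' : j.+1 * ar i <= size (records S i) * ar i by rewrite leq_mul2r hj orbT.
  apply: sp_cload; [by lia|by rewrite hR ?h1; lia|rewrite hRd; lia|].
  move=> R2 h2R h2d h2f; refine (sp_nil _).
  have hR2 : agree_below d R0 R2 by move=> x hx; rewrite h2R ?hR; lia.
  apply: wp_mono (hbody j (nseq_tuple (ar i) (Ordinal n_gt0)) R2 M hj hR2 _ hIj) _ _ => //.
    move=> a; rewrite h2f // hRd (hread _ _ hIj); first exact: hinp.
    by have := ltn_ord a; lia.
  move=> R' M' [h hI']; split.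
  + by rewrite h ?h2R //; lia.
  + by rewrite h ?h2R //; lia.
  + by rewrite h ?hR2 ?h1 //; lia.
  split => //.
    by apply: agree_below_upd => // x hx; rewrite h ?hR2 //; lia.
  by rewrite upd_neq ?h ?h2d ?hRd; lia.
- split; first by apply: agree_below_upd.
    by rewrite upd_neq /R1 ?upd_eq; lia.
  by [].
by move=> R' M' [h _ hI'].
Qed.

(** * The contents of the memory *)

(* Arrays 0, ..., r - 1 tabulate the relations, array r holds the marks, array
   r + 1 the values and array r + 2 a single accumulator.  Numbers are known
   only modulo 2 ^ w, so that no intermediate result has to be bounded. *)
Definition mem_inv (M : nat -> nat) (P : forall i, seq ((ar i).-tuple 'I_n))
    (D : {set env}) (V : k.-tuple 'I_n -> nat) (acc : nat) : Prop :=
  [/\ reads_input M,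
      forall i (rho : (ar i).-tuple 'I_n),
        M (cell i (idx n [seq val o | o <- rho])) = (rho \in P i),
      forall e : env, M (cell r (idx n [seq val o | o <- e])) = (e \in D),
      forall x : k.-tuple 'I_n,
        M (cell r.+1 (idx n [seq val o | o <- x])) = V x %% 2 ^ w
    & M (cell r.+2 0) = acc %% 2 ^ w].

Lemma idx_region m (x : m.-tuple 'I_n) :
  m <= k + l + \sum_(i < r) ar i -> idx n [seq val o | o <- x] < region.
Proof. by move=> /exp_le_region; apply: leq_trans (idx_tuple_lt x). Qed.

Lemma idx_rec i (x : (ar i).-tuple 'I_n) : idx n [seq val o | o <- x] < region.
Proof. exact: idx_region (ar_le i). Qed.

Lemma idx_env (x : env) : idx n [seq val o | o <- x] < region.
Proof. by apply: idx_region; lia. Qed.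

Lemma idx_head (x : k.-tuple 'I_n) : idx n [seq val o | o <- x] < region.
Proof. by apply: idx_region; lia. Qed.

Lemma upd_cell M j x v j' x' : x < region -> x' < region ->
  upd M (cell j x) v (cell j' x') = if (j == j') && (x == x') then v
                                    else M (cell j' x').
Proof.
move=> hx hx'; rewrite /upd; case: ifPn => [/eqP /cell_inj|].
  by move=> /(_ hx' hx) [-> ->]; rewrite !eqxx.
by move=> h; rewrite ifN //; apply: contra h => /andP [/eqP -> /eqP ->].
Qed.

Lemma upd_cell_input M j x v : reads_input M -> reads_input (upd M (cell j x) v).
Proof. by move=> h a ha; rewrite upd_neq ?h // /cell; lia. Qed.

Lemma mem_inv_mark M P D V acc (e : env) :
  mem_inv M P D V acc ->
  mem_inv (upd M (cell r (idx n [seq val o | o <- tval e])) 1) P (e |: D) V acc.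
Proof.
move=> [h1 h2 h3 h4 h5]; have he := idx_env e; split.
- exact: upd_cell_input.
- move=> i rho; rewrite upd_cell ?idx_rec // ifN //.
  by have := ltn_ord i; lia.
- move=> e'; rewrite upd_cell ?idx_env // eqxx in_setU1 /=.
  case: (eqVneq e' e) => [->|ne]; first by rewrite eqxx.
  by rewrite ifN ?h3 //; apply: contra ne => /eqP /idx_tuple_inj ->.
- by move=> x; rewrite upd_cell ?idx_head // ifN //; lia.
- by rewrite upd_cell ?region_gt0 // ifN //; lia.
Qed.

Lemma mem_inv_val M P D V V' acc (x : k.-tuple 'I_n) :
  mem_inv M P D V acc -> (forall x', x' != x -> V' x' = V x') ->
  mem_inv (upd M (cell r.+1 (idx n [seq val o | o <- tval x])) (V' x %% 2 ^ w))
    P D V' acc.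
Proof.
move=> [h1 h2 h3 h4 h5] hV; have hx := idx_head x; split.
- exact: upd_cell_input.
- move=> i rho; rewrite upd_cell ?idx_rec // ifN //.
  by have := ltn_ord i; lia.
- by move=> e'; rewrite upd_cell ?idx_env // ifN //; lia.
- move=> x'; rewrite upd_cell ?idx_head // eqxx /=.
  case: eqP => [/idx_tuple_inj -> //|ne].
  by rewrite h4 hV //; apply/eqP => e; rewrite e in ne.
- by rewrite upd_cell ?region_gt0 // ifN //; lia.
Qed.

Lemma mem_inv_acc M P D V acc v :
  mem_inv M P D V acc ->
  mem_inv (upd M (cell r.+2 0) (v %% 2 ^ w)) P D V v.
Proof.
move=> [h1 h2 h3 h4 h5]; have h0 := region_gt0; split.
- exact: upd_cell_input.
- move=> i rho; rewrite upd_cell ?idx_rec // ifN //.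
  by have := ltn_ord i; lia.
- by move=> e'; rewrite upd_cell ?idx_env // ifN //; lia.
- by move=> x; rewrite upd_cell ?idx_head // ifN //; lia.
- by rewrite upd_eq.
Qed.

(** * Correctness of the loop bodies *)

Definition head_env (e : env) : k.-tuple 'I_n :=
  [tuple tnth e (lshift l i) | i < k].

Lemma env_regsE R Z (e : env) : holds_env R Z e ->
  [seq R x | x <- env_regs Z] = [seq val o | o <- e].
Proof.
move=> he; rewrite /env_regs -val_enum_ord -map_comp -map_comp.
rewrite -[in RHS](map_tnth_enum e).
by rewrite -[RHS]map_comp; apply: eq_map => o /=; rewrite he.
Qed.

Lemma head_regsE R Z (e : env) : holds_env R Z e ->
  [seq R x | x <- head_regs Z] = [seq val o | o <- head_env e].
Proof.
move=> he; rewrite /head_regs -val_enum_ord -map_comp -map_comp.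
rewrite -[in RHS](map_tnth_enum (head_env e)) -[RHS]map_comp.
by apply: eq_map => o /=; rewrite tnth_mktuple -he.
Qed.

Lemma sp_caddr_env d Z s R M Q e :
  depth0 <= Z -> Z + (k + l) <= d -> glob R -> holds_env R Z e ->
  (forall R', agree_below d R R' ->
     R' d = cell r (idx n [seq val o | o <- tval e]) -> sp w s R' M Q) ->
  sp w (caddr d r (env_regs Z) ++ s) R M Q.
Proof.
move=> hZ hd hg he hs; apply: sp_caddr => //; try lia.
- by apply/allP => x /mapP [o]; rewrite mem_iota => ? ->; lia.
- by rewrite (env_regsE he) all_val_lt.
- by rewrite size_map size_iota; apply: exp_le_region; lia.
by move=> R' hR'; rewrite (env_regsE he); apply: hs.
Qed.

Lemma sp_caddr_head d Z s R M Q e :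
  depth0 <= Z -> Z + (k + l) <= d -> glob R -> holds_env R Z e ->
  (forall R', agree_below d R R' ->
     R' d = cell r.+1 (idx n [seq val o | o <- tval (head_env e)]) ->
     sp w s R' M Q) ->
  sp w (caddr d r.+1 (head_regs Z) ++ s) R M Q.
Proof.
move=> hZ hd hg he hs; apply: sp_caddr => //; try lia.
- by apply/allP => x /mapP [o]; rewrite mem_iota => ? ->; lia.
- by rewrite (head_regsE he) all_val_lt.
- by rewrite size_map size_iota; apply: exp_le_region; lia.
by move=> R' hR'; rewrite (head_regsE he); apply: hs.
Qed.

Definition zero_env : env := nseq_tuple (k + l) (Ordinal n_gt0).

Lemma size_env_regs Z : size (env_regs Z) = k + l.
Proof. by rewrite size_map size_iota. Qed.

Lemma wp_czero Z R M (Q : _ -> _ -> Prop) :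
  (forall R', agree_below Z R R' -> holds_env R' Z zero_env -> Q R' M) ->
  wp w (czero Z) (k + l) R M Q.
Proof.
move=> hQ; rewrite -(size_env_regs Z) -(size_map (SetC^~ 0)).
apply: wp_block; first by rewrite all_map; apply/allP.
suff gen m (R1 : nat -> nat) : m <= k + l -> agree_below Z R R1 ->
    (forall i, i < k + l - m -> R1 (Z + i) = 0) ->
    sp w [seq SetC x 0 | x <- [seq Z + i | i <- iota (k + l - m) m]] R1 M Q.
  by move: (gen (k + l) R); rewrite subnn; apply.
elim: m R1 => [|m IH] R1 hm hR1 h0.
  refine (sp_nil _); apply: hQ => // o; rewrite h0; last by have := ltn_ord o; lia.
  by rewrite tnth_nseq.
refine (sp_set _ _); first by have := word_gt3; lia.
have -> : (k + l - m.+1).+1 = k + l - m by lia.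
apply: IH; first by lia.
  by apply: agree_below_upd => //; lia.
move=> i hi; rewrite /upd; case: eqP => // ne; apply: h0; lia.
Qed.

Lemma sp_ccount Z f R M D V acc e :
  depth0 <= Z -> glob R -> holds_env R Z e ->
  mem_inv M (records S) D V acc ->
  sp w (ccount Z f) R M (fun R' M' => agree_below (Z + (k + l)) R R' /\
    mem_inv M' (records S) D V (acc + holds e f)).
Proof.
move=> hZ hg he hM; rewrite /ccount; set d := Z + (k + l).
have [_ hT _ _ hacc] := hM.
apply: (sp_ceval (Z := Z) (e := e)) => // R1 hR1 eR1.
have [_ _ h3 _ _] : glob R1.
  by apply: glob_agree hg; apply: agree_below_leq hR1; lia.
have hb : rbase r.+2 < d by move: hZ; rewrite /rbase /depth0; lia.
have hd : d != d.+1 by lia.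
refine (sp_read _); rewrite h3 ?hacc; last by lia.
refine (sp_plusm _); rewrite upd_eq (upd_neq _ _ hd) eR1.
refine (sp_write _).
rewrite upd_eq !upd_neq ?h3; try lia.
rewrite modnDmr addnC; refine (sp_nil _); split.
  by apply: agree_below_upd => //; apply: agree_below_upd => //; lia.
exact: mem_inv_acc hM.
Qed.

Lemma sp_cadd Z f R M D V acc e :
  depth0 <= Z -> glob R -> holds_env R Z e ->
  mem_inv M (records S) D V acc ->
  sp w (cadd Z f) R M (fun R' M' => agree_below (Z + (k + l)) R R' /\
    mem_inv M' (records S) D
      (fun x => V x + acc * ((head_env e == x) && holds e f)) acc).
Proof.
move=> hZ hg he hM; rewrite /cadd; set d := Z + (k + l).
have [_ hT _ hV hacc] := hM.
apply: (sp_ceval (Z := Z) (e := e)) => // R1 hR1 eR1.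
have g1 : glob R1 by apply: glob_agree hg; apply: agree_below_leq hR1; lia.
have [_ _ h3 _ _] := g1.
have hd : d != d.+1 by lia.
refine (sp_read _); rewrite h3 ?hacc; last by lia.
refine (sp_timesm _); rewrite upd_eq (upd_neq _ _ hd) eR1 modnMmr.
set R2 := upd _ d _; have hR2 : agree_below d R R2.
  by apply: agree_below_upd => //; apply: agree_below_upd => //; lia.
apply: (sp_caddr_head (Z := Z) (e := e)) => //; try lia.
- by apply: glob_agree hg; apply: agree_below_leq hR2; lia.
- by apply: holds_env_agree hR2 _ he; lia.
move=> R3 hR3 eR3; refine (sp_read _); rewrite eR3 hV.
have e3 : R3 d = (holds e f * acc) %% 2 ^ w by rewrite hR3 // /R2 upd_eq.
refine (sp_plusm _); rewrite upd_eq upd_neq ?e3; last by lia.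
 refine (sp_write _).
rewrite upd_eq !upd_neq ?eR3; try lia.
refine (sp_nil _); split.
  apply: agree_below_upd => //; apply: agree_below_upd; last by lia.
  by apply: agree_below_trans hR2 _; apply: agree_below_leq hR3; lia.
have -> : ((holds e f * acc) %% 2 ^ w + V (head_env e) %% 2 ^ w) %% 2 ^ w
   = (V (head_env e) + acc * ((head_env e == head_env e) && holds e f)) %% 2 ^ w.
  by rewrite modnDm eqxx addnC mulnC.
pose V' x := V x + acc * ((head_env e == x) && holds e f).
apply: (@mem_inv_val _ _ _ V V') => // x ne.
by rewrite /V' eq_sym (negPf ne) muln0 addn0.
Qed.

Lemma mem_inv_ext M P D V V' acc :
  V =1 V' -> mem_inv M P D V acc -> mem_inv M P D V' acc.
Proof. by move=> hV [h1 h2 h3 h4 h5]; split => // x; rewrite h4 hV. Qed.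

Lemma tnth_set_var e v a o :
  tnth (set_var e v a) o = if o == v then a else tnth e o.
Proof. by rewrite tnth_mktuple. Qed.

Lemma mem_env_list vs e e' :
  (e' \in env_list vs e) = [forall o, (o \in vs) || (tnth e' o == tnth e o)].
Proof.
elim: vs e => [|v vs IH] e /=.
  rewrite inE; apply/eqP/forallP => [-> //|h].
  by apply: eq_from_tnth => o; apply/eqP; have := h o.
apply/flattenP/forallP => [[s /mapP [a _ ->]]|h].
  rewrite IH => /forallP h o; have := h o; rewrite tnth_set_var inE.
  by case: (o == v).
exists (env_list vs (set_var e v (tnth e' v))); first by apply: map_f; rewrite mem_enum.
rewrite IH; apply/forallP => o; have := h o; rewrite tnth_set_var inE.
by case: eqP => [->|]; rewrite ?eqxx ?orbT.
Qed.

(** Different values of [v] give disjoint sublists, because [v] does not occur in the remaining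
    variables and is never overwritten. *)
Lemma uniq_env_list vs e : uniq vs -> uniq (env_list vs e).
Proof.
elim: vs e => [//|v vs IH] e /= /andP [vvs uvs].
have := enum_uniq 'I_n; elim: (enum 'I_n) => [//|a s IHs] /= /andP [has us].
rewrite cat_uniq IH // IHs // andbT; apply/hasPn => e'.
move=> /flattenP [_ /mapP [b hb ->]] /=; rewrite !mem_env_list => /forallP h.
apply/negP => /forallP h'; have := h v; have := h' v.
rewrite (negPf vvs) !tnth_set_var eqxx /= => /eqP -> /eqP ab.
by rewrite ab hb in has.
Qed.

(** The value table while [D] is the set of marked assignments: phi has replaced phi0 exactly on
    [D]. *)
Definition corrected (D : {set env}) (x : k.-tuple 'I_n) : nat :=
  \sum_(e : env | head_env e == x)
     (if e \in D then holds e phi else holds e unmixed).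

(** Stated additively because subtraction on [nat] truncates; [ccorrect] likewise adds phi before
    subtracting phi0. *)
Lemma corrected_setU1 (D : {set env}) e : e \notin D ->
  corrected (e |: D) (head_env e) + holds e unmixed
  = corrected D (head_env e) + holds e phi.
Proof.
move=> he; rewrite /corrected (bigD1 e) //= [in RHS](bigD1 e) //=.
rewrite in_setU1 eqxx (negPf he) /= addnAC [in RHS]addnAC; congr (_ + _).
  exact: addnC.
apply: eq_bigr => e' /andP [_ ne].
by rewrite in_setU1 (negPf ne).
Qed.

Lemma corrected_setU1_neq (D : {set env}) e x : x != head_env e ->
  corrected (e |: D) x = corrected D x.
Proof.
move=> hx; apply: eq_bigr => e' /eqP he'; rewrite in_setU1.
by case: eqP => // ee; rewrite -he' ee eqxx in hx.
Qed.

Lemma modn_sub_cancel m a b c : b <= m -> c + b = a ->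
  (a %% m + m - b) %% m = c %% m.
Proof.
move=> hb <-; rewrite -addnBA // modnDml.
by rewrite -addnA subnKC // modnDr.
Qed.

(** For a marked [e] both increments vanish and [e |: D] is [D]; for a new one the change of the
    table is that of [corrected_setU1]. *)
Lemma sp_ccorrect Z R M D acc e :
  depth0 <= Z -> glob R -> holds_env R Z e ->
  mem_inv M (records S) D (corrected D) acc ->
  sp w (ccorrect Z) R M (fun R' M' => agree_below (Z + (k + l)) R R' /\
    mem_inv M' (records S) (e |: D) (corrected (e |: D)) acc).
Proof.
move=> hZ hg he hM; rewrite /ccorrect; set d := Z + (k + l).
have [_ hT hD hV _] := hM; have hW := word_gt3.
have hZd : depth0 <= d by rewrite /d; lia.
apply: (sp_caddr_env (Z := Z) (e := e)) => // R1 hR1 eR1.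
have g1 : glob R1 by apply: glob_agree hg; apply: agree_below_leq hR1; lia.
have [h1 _ _ _ _] := g1; have h1d : 1 < d by move: hZd; rewrite /depth0; lia.
refine (sp_read _); rewrite eR1 hD.
refine (sp_minus _ _ _); rewrite ?upd_eq ?upd_neq ?h1 //; try lia.
set R2 := upd _ d.+1 _.
have hR2d : agree_below d R R2 by do 2! [apply: agree_below_upd; last by lia].
have hR2 x : x < d -> R2 x = R x by apply: hR2d.
have R2d : R2 d = cell r (idx n [seq val o | o <- tval e]).
  by rewrite /R2 !upd_neq ?eR1; lia.
have R2d1 : R2 d.+1 = (e \notin D) by rewrite /R2 upd_eq; case: (e \in D).
move: R2 hR2d hR2 R2d R2d1 => R2 hR2d hR2 R2d R2d1.
apply: (sp_ceval (Z := Z) (e := e)) => //; try lia.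
- exact: glob_agree (agree_below_leq hZd hR2d) hg.
- exact: holds_env_agree hR2d (leqnn _) he.
move=> R3 hR3 eR3.
have e3 : R3 d.+1 = (e \notin D) by rewrite hR3 ?R2d1; lia.
refine (sp_times _ _); rewrite eR3 e3; first by case: holds; case: (e \in D); lia.
set R4 := upd R3 _ _.
have hR4 : agree_below (d + 2) R2 R4 by apply: agree_below_upd.
have hR4d : agree_below d R R4.
  by apply: agree_below_trans hR2d _; apply: agree_below_leq hR4; lia.
apply: (sp_ceval (Z := Z) (e := e)) => //; try lia.
- exact: glob_agree (agree_below_leq hZd hR4d) hg.
- exact: holds_env_agree hR4d (leqnn _) he.
move=> R5 hR5 eR5.
have e5 : R5 d.+1 = (e \notin D) by rewrite hR5 ?hR4 ?R2d1; lia.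
refine (sp_times _ _); rewrite eR5 e5; first by case: holds; case: (e \in D); lia.
set R6 := upd R5 _ _.
have hR6 : agree_below (d + 3) R4 R6 by apply: agree_below_upd.
have hR6d : agree_below d R R6.
  by apply: agree_below_trans hR4d _; apply: agree_below_leq hR6; lia.
apply: (sp_caddr_head (Z := Z) (e := e)) => //; try lia.
- exact: glob_agree (agree_below_leq hZd hR6d) hg.
- exact: holds_env_agree hR6d (leqnn _) he.
move=> R7 hR7 eR7.
have R7b : R7 (d + 3) = holds e unmixed * (e \notin D).
  by rewrite hR7 /R6 ?upd_eq; lia.
have R7a : R7 (d + 2) = holds e phi * (e \notin D).
  by rewrite hR7 ?hR6 /R4 ?upd_eq; lia.
have R7d : R7 d = cell r (idx n [seq val o | o <- tval e]).
  by rewrite hR7 ?hR6 ?hR4 ?R2d; lia.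
have R71 : R7 1 = 1 by rewrite hR7 ?hR6d -?hR1 ?h1; lia.
refine (sp_read _); rewrite eR7 hV.
refine (sp_plusm _); rewrite upd_eq upd_neq ?R7a; last by lia.
refine (sp_minusm _); rewrite upd_eq !upd_neq ?R7b; try lia.
refine (sp_write _); rewrite upd_eq !upd_neq ?eR7; try lia.
refine (sp_write _); rewrite !upd_neq ?R7d ?R71; try lia.
refine (sp_nil _); split.
  do 3! [apply: agree_below_upd; last by lia].
  by apply: agree_below_trans hR6d _; apply: agree_below_leq hR7; lia.
apply: mem_inv_mark; rewrite modnDml (@modn_sub_cancel _ _ _ (corrected (e |: D) (head_env e))).
- by apply: mem_inv_val hM _ => x ne; apply: corrected_setU1_neq.
- by case: holds; case: (e \in D); lia.
case: (boolP (e \in D)) => heD /=.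
  by rewrite !muln0 !addn0 (setUidPr _) // sub1set.
by rewrite !muln1 corrected_setU1.
Qed.

(** * Correctness of the phases *)

Lemma mem_inv_table M (P P' : forall i, seq ((ar i).-tuple 'I_n)) D V acc i
    (rho : (ar i).-tuple 'I_n) :
  mem_inv M P D V acc ->
  (forall i' (rho' : (ar i').-tuple 'I_n), i' != i ->
     (rho' \in P' i') = (rho' \in P i')) ->
  (forall rho', (rho' \in P' i) = (rho' == rho) || (rho' \in P i)) ->
  mem_inv (upd M (cell i (idx n [seq val o | o <- tval rho])) 1) P' D V acc.
Proof.
move=> [h1 h2 h3 h4 h5] hne heq; have hx := idx_rec rho; have hi := ltn_ord i.
split.
- exact: upd_cell_input.
- move=> i' rho'; rewrite upd_cell ?idx_rec //.
  case: (eqVneq i' i) rho' => [-> rho'|ne rho']; last first.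
    by rewrite ifN ?h2 ?hne //; apply: contra ne => /andP [/eqP/val_inj/esym/eqP].
  rewrite eqxx heq /=; case: (eqVneq rho' rho) => [->|ne]; first by rewrite eqxx.
  by rewrite ifN ?h2 //; apply: contra ne => /eqP /idx_tuple_inj ->.
- by move=> e; rewrite upd_cell ?idx_env // ifN //; lia.
- by move=> x; rewrite upd_cell ?idx_head // ifN //; lia.
- by rewrite upd_cell ?region_gt0 // ifN //; lia.
Qed.

Definition tables_of (s : seq 'I_r) (i : 'I_r) : seq ((ar i).-tuple 'I_n) :=
  if i \in s then records S i else [::].

Lemma wp_ctable i s R0 M0 D V acc :
  glob R0 -> i \notin s -> mem_inv M0 (tables_of s) D V acc ->
  wp w (ctable i) (2 + (size (records S i) * (2 * ar i + size (centry i) + 3) + 3))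
    R0 M0 (fun R' M' => agree_below depth0 R0 R' /\
      mem_inv M' (tables_of (rcons s i)) D V acc).
Proof.
move=> hg hi hM.
(* Partial tables: the relations in [s] are complete, and relation [i] contains its first [t]
   records. *)
pose P t i' := if i' == i then take t (records S i') else tables_of s i'.
pose I t M := mem_inv M (P t) D V acc.
have hW := word_gt3; have hir := ltn_ord i.
apply: wp_mono (wp_crecords (I := I) (leqnn _) hg _ _ _) _ _ => //.
- by move=> t M [].
- move=> j rho0 R M hj hR hf hI.
  have g1 := glob_agree hR hg; have [h1 _ _ _ _] := g1.
  apply: wp_block; first by rewrite all_cat straight_caddr.
  set rho := nth rho0 _ _ in hf.
  have fE : [seq R x | x <- [seq depth0 + 2 + a | a <- iota 0 (ar i)]]
      = [seq val o | o <- tval rho].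
    rewrite -val_enum_ord -map_comp -map_comp -[in RHS](map_tnth_enum rho).
    by rewrite -[RHS]map_comp; apply: eq_map => a /=; rewrite hf.
  apply: sp_caddr => //; try lia.
  + by apply/allP => x /mapP [a]; rewrite mem_iota => ? ->; lia.
  + by rewrite fE all_val_lt.
  + by rewrite size_map size_iota exp_le_region // ar_le.
  move=> R1 hR1; rewrite fE => eR1; refine (sp_write _); refine (sp_nil _).
  split => //; rewrite eR1 hR1 ?h1; last by rewrite /depth0; lia.
  apply: mem_inv_table hI _ _ => [i' rho' ne|rho'].
    by rewrite /P (negPf ne).
  by rewrite /P eqxx (take_nth rho0) // mem_rcons inE.
- case: hM => [h1 h2 h3 h4 h5]; split => // i' rho'; rewrite h2 /P.
  by case: eqP rho' => [-> rho'|//]; rewrite take0 /tables_of (negPf hi).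
move=> R' M' [hR' [h1 h2 h3 h4 h5]]; split => //; split => // i' rho'.
rewrite h2 /P /tables_of mem_rcons inE.
by case: eqP rho' => [-> rho'|//]; rewrite take_size.
Qed.


Definition type_count (tau : {ffun 'I_r -> bool}) : nat :=
  \sum_(e <- env_list [:: last_var] zero_env) holds e (has_type tau).

Definition type_part (tau : {ffun 'I_r -> bool}) (x : k.-tuple 'I_n) : nat :=
  \sum_(e <- env_list vars_but_last zero_env | head_env e == x)
     holds e (unmixed_at tau).

Lemma uniq_vars_but_last : uniq vars_but_last.
Proof. by rewrite filter_uniq // enum_uniq. Qed.

Lemma straight_ccount Z f : all is_straight (ccount Z f).
Proof. by rewrite all_cat straight_ceval. Qed.

Lemma straight_cadd Z f : all is_straight (cadd Z f).
Proof. by rewrite /cadd 3!all_cat straight_ceval straight_caddr. Qed.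

Lemma straight_ccorrect Z : all is_straight (ccorrect Z).
Proof.
by rewrite /ccorrect all_cat straight_caddr 6!all_cat !straight_ceval
  straight_caddr.
Qed.

Lemma wp_ctype tau R0 M0 D V acc :
  glob R0 -> mem_inv M0 (records S) D V acc ->
  wp w (ctype tau)
    (2 + (k + l + (nest_cost (size (ccount depth0 (has_type tau))) [:: last_var] +
     (k + l + nest_cost (size (cadd depth0 (unmixed_at tau))) vars_but_last))))
    R0 M0 (fun R' M' => agree_below depth0 R0 R' /\
      mem_inv M' (records S) D
        (fun x => V x + type_count tau * type_part tau x) (type_count tau)).
Proof.
move=> hg hM; have hW := word_gt3; have [_ _ h3 _ _] := hg.
apply: wp_seq; apply: wp_block => //.
refine (sp_set _ _); first by lia.
refine (sp_write _); rewrite upd_eq upd_neq ?h3 /rbase /depth0; try lia.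
rewrite -/depth0; refine (sp_nil _).
set R1 := upd _ _ _; have hR1 : agree_below depth0 R0 R1 by apply: agree_below_upd.
have {}hM : mem_inv (upd M0 (cell r.+2 0) 0) (records S) D V 0.
  by have := mem_inv_acc 0 hM; rewrite mod0n.
move: (upd M0 _ _) hM => M1 hM1.
apply: wp_seq; apply: wp_czero => R2 hR2 he2.
have {}hR2 := agree_below_trans hR1 hR2.
pose I1 (s : seq env) M :=
  mem_inv M (records S) D V (\sum_(e <- s) holds e (has_type tau)).
apply: wp_seq; apply: wp_mono (wp_nest (I := I1) (leqnn _) hg _
    (vs := [:: last_var]) (done := [::]) (e := zero_env) _ hR2 _ _) (leqnn _) _.
- move=> s e R M hR he hI; apply: wp_block; first exact: straight_ccount.
  apply: sp_mono (sp_ccount _ (leqnn _) (glob_agree hR hg) he hI) _.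
  by move=> R' M' [? h]; split => //; rewrite /I1 big_rcons.
- by [].
- by move=> o _; apply: he2.
- by rewrite /I1 big_nil.
move=> R3 M3 [hR3 hM3].
have {}hR3 : agree_below depth0 R0 R3.
  move=> x hx; rewrite hR3 ?hR2 //; first by lia.
  by apply/mapP => -[v _ e]; lia.
apply: wp_seq; apply: wp_czero => R4 hR4 he4.
have {}hR4 := agree_below_trans hR3 hR4.
pose I2 (s : seq env) M :=
  mem_inv M (records S) D (fun x => V x + type_count tau *
    \sum_(e <- s | head_env e == x) holds e (unmixed_at tau)) (type_count tau).
apply: wp_mono (wp_nest (I := I2) (leqnn _) hg _
    (vs := vars_but_last) (done := [::]) (e := zero_env) _ hR4 _ _) (leqnn _) _.
- move=> s e R M hR he hI; apply: wp_block; first exact: straight_cadd.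
  apply: sp_mono (sp_cadd _ (leqnn _) (glob_agree hR hg) he hI) _.
  move=> R' M' [? h]; split => //; apply: mem_inv_ext h => x.
  by rewrite big_rcons -addnA -mulnDr; case: ifP.
- exact: uniq_vars_but_last.
- by move=> o _; apply: he4.
- by apply: mem_inv_ext hM3 => x; rewrite big_nil muln0 addn0.
move=> R5 M5 [hR5 hM5]; split => // x hx.
rewrite hR5 ?hR4 //; first by lia.
by apply/mapP => -[v _ e]; lia.
Qed.

(** The marked set is only known to grow and to contain the assignments that match a record at the
    given positions. Growth preserves what earlier positions have covered. *)
Lemma wp_cmixed i a b j R0 M0 D0 acc :
  glob R0 -> j != last_var -> mem_inv M0 (records S) D0 (corrected D0) acc ->
  wp w (cmixed (existT _ i (a, b, j)))
    (2 + (size (records S i) * (2 * ar i +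
       (4 + nest_cost (size (ccorrect (depth0 + 2 + ar i)))
              [seq v <- vars_but_last | v != j]) + 3) + 3))
    R0 M0 (fun R' M' => agree_below depth0 R0 R' /\
      exists D : {set env}, [/\ mem_inv M' (records S) D (corrected D) acc,
        D0 \subset D &
        forall rho (e : env), rho \in records S i -> tnth e j = tnth rho a ->
          tnth e last_var = tnth rho b -> e \in D]).
Proof.
move=> hg hj hM; have hW := word_gt3; set Z := depth0 + 2 + ar i.
pose I t M := exists D : {set env}, [/\ mem_inv M (records S) D (corrected D) acc,
  D0 \subset D &
  forall rho (e : env), rho \in take t (records S i) -> tnth e j = tnth rho a ->
    tnth e last_var = tnth rho b -> e \in D].
apply: wp_mono (wp_crecords (I := I) (leqnn _) hg _ _ _) _ _ => //.
- by move=> t M [D [[]]].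
- move=> t rho0 R M ht hR hf [D [hD hD0 hDt]].
  set rho := nth rho0 _ _ in hf.
  apply: wp_seq; apply: wp_block => //.
  have nW : n < 2 ^ w by apply: leq_ltn_trans n_le_region region_lt.
  have hv (o : 'I_n) : o < 2 ^ w by apply: ltn_trans nW.
  have ha := ltn_ord a; have hb := ltn_ord b.
  have hjl : nat_of_ord j != last_var by [].
  refine (sp_set _ _); first by lia.
  refine (sp_plus _ _); rewrite upd_eq upd_neq ?hf; try (by rewrite /Z; lia);
    first exact: hv.
  refine (sp_set _ _); first by lia.
  refine (sp_plus _ _); rewrite upd_eq !upd_neq ?hf; try (by rewrite /Z; lia);
    first exact: hv.
  rewrite !add0n; refine (sp_nil _); set R1 := upd _ _ _.
  have hR1 : agree_below Z R R1.
    by do 4! [apply: agree_below_upd; last by lia].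
  (* The starting point of the nest: two variables come from the record, and the zeros elsewhere are
     overwritten by the loops. *)
  pose e := set_var (set_var zero_env j (tnth rho a)) last_var (tnth rho b).
  pose I2 (s : seq env) M :=
    mem_inv M (records S) ([set e in s] :|: D) (corrected ([set e in s] :|: D)) acc.
  have gR1 : glob R1.
    apply: glob_agree hg; apply: agree_below_trans hR _.
    by apply: agree_below_leq hR1; rewrite /Z; lia.
  apply: wp_mono (wp_nest (I := I2) (Z := Z) _ gR1 _
    (vs := [seq v <- vars_but_last | v != j]) (done := [::]) (e := e) _ _ _ _)
    (leqnn _) _.
  + by rewrite /Z; lia.
  + move=> s e' R' M' hR' he' hI; apply: wp_block; first exact: straight_ccorrect.
    have hZ : depth0 <= Z by rewrite /Z; lia.
    apply: sp_mono (sp_ccorrect hZ _ he' hI) _.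
      exact: glob_agree (agree_below_leq hZ hR') gR1.
    move=> R2 M2 [? h]; split => //; rewrite /I2.
    have -> // : [set e in rcons s e'] :|: D = e' |: ([set e in s] :|: D).
    by apply/setP => u; rewrite !inE mem_rcons inE orbA.
  + by rewrite filter_uniq // uniq_vars_but_last.
  + by [].
  + move=> o; rewrite /vars_but_last 2!mem_filter mem_enum andbT negb_and !negbK /e !tnth_set_var.
    rewrite /R1 /upd !eqn_add2l -!val_eqE /=.
    by case/orP => /eqP ->; rewrite eqxx //; case: eqP.
  + rewrite /I2 (_ : _ :|: D = D) //.
    by apply/setP => u; rewrite !inE.
  move=> R2 M2 [hR2 hM2]; split.
    move=> x hx; rewrite hR2 ?hR1 //; first by rewrite /Z; lia.
    by apply/mapP => -[v _ ev]; lia.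
  exists ([set e' in env_list [seq v <- vars_but_last | v != j] e] :|: D); split.
  + exact: hM2.
  + by apply: subset_trans hD0 _; apply: subsetUr.
  (* An assignment matching the current record agrees with [e] at [j] and at the last variable,
     hence is enumerated by the nest; one matching an earlier record is already in [D]. *)
  move=> rho' e'; rewrite (take_nth rho0) // mem_rcons inE => /orP [/eqP ->|h] ea eb.
    rewrite !inE mem_env_list; apply/orP; left; apply/forallP => o.
    rewrite /vars_but_last 2!mem_filter mem_enum andbT /e !tnth_set_var.
    case: (eqVneq o last_var) => [->|_]; first by rewrite eb eqxx orbT.
    by case: (eqVneq o j) => [->|//]; rewrite ea eqxx orbT.
  by rewrite inE (hDt rho') ?orbT.
- by exists D0; split => // rho e; rewrite take0.
move=> R' M' [hR' [D [hD hD0 hDt]]]; split => //; exists D; split => //.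
by move=> rho e h; apply: hDt; rewrite take_size.
Qed.

(** * Counting *)

Hypothesis l_gt0 : 0 < l.

Lemma holds_const (e : env) b : holds e (const_form b) = b.
Proof. by case: b; rewrite /= ?orbN ?andbN. Qed.

Lemma holds_map_atoms (e e' : env) g g' f :
  (forall i (v : (ar i).-tuple 'I_(k + l)), holds e (g i v) = holds e' (g' i v)) ->
  holds e (map_atoms g f) = holds e' (map_atoms g' f).
Proof.
move=> h; elim: f => //= [f ->|f -> f' ->|f -> f' ->] //.
Qed.

Lemma map_atoms_id (f : qformula ar (k + l)) : map_atoms (@Atom _ _ _) f = f.
Proof. by elim: f => //= [f ->|f -> f' ->|f -> f' ->]. Qed.

Definition type_of (a : 'I_n) : {ffun 'I_r -> bool} :=
  [ffun i => nseq_tuple (ar i) a \in records S i].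

Lemma map_nseq_tuple (e : env) m (o : 'I_(k + l)) :
  map_tuple (tnth e) (nseq_tuple m o) = nseq_tuple m (tnth e o).
Proof. by apply: eq_from_tnth => i; rewrite tnth_map !tnth_nseq. Qed.

Lemma holds_has_type (e : env) tau :
  holds e (has_type tau) = (tau == type_of (tnth e last_var)).
Proof.
have -> : holds e (has_type tau) =
    all (fun i => tau i == type_of (tnth e last_var) i) (enum 'I_r).
  rewrite /has_type; elim: (enum 'I_r) => [|i s IH]; first exact: holds_const.
  rewrite /= -IH ffunE -map_nseq_tuple.
  by case: (tau i) => /=; case: (_ \in _).
apply/allP/eqP => [h|-> //].
by apply/ffunP => i; apply/eqP/h; rewrite mem_enum.
Qed.

(** Atom by atom: without the last variable its value is irrelevant, with no other variable the type
    decides, and mixed atoms are false on both sides. *)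
Lemma holds_unmixed_at (e : env) a :
  holds e (unmixed_at (type_of a)) = holds (set_var e last_var a) unmixed.
Proof.
apply: holds_map_atoms => i v; rewrite /mixed.
case: (boolP (last_var \in v)) => hv /=; last first.
  suff -> : map_tuple (tnth (set_var e last_var a)) v = map_tuple (tnth e) v by [].
  apply: eq_from_tnth => o; rewrite tnth_map tnth_set_var tnth_map.
  by case: eqP => // ev; rewrite -ev mem_tnth in hv.
case: (boolP (all (pred1 last_var) v)) => ha /=; last by rewrite !andbN.
rewrite holds_const ffunE.
suff -> : map_tuple (tnth (set_var e last_var a)) v = nseq_tuple (ar i) a by [].
apply: eq_from_tnth => o; rewrite tnth_nseq tnth_map tnth_set_var ifT //.
exact: (allP ha) (mem_tnth _ _).
Qed.

(** Since [l] is positive, the last variable is one of the y, so changing it does not affect the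
    tuple x. *)
Lemma lshift_last i : (lshift l i == last_var) = false.
Proof. by rewrite -val_eqE /=; apply/eqP; have := ltn_ord i; lia. Qed.

Lemma head_set_last e a : head_env (set_var e last_var a) = head_env e.
Proof.
apply: eq_from_tnth => i.
by rewrite !tnth_mktuple lshift_last.
Qed.

(** An assignment corresponds to its last value together with the assignment in which that value is
    reset to 0; [env_list vars_but_last zero_env] lists these representatives. *)
Lemma sum_by_last (F : env -> nat) x :
  \sum_(e : env | head_env e == x) F e =
  \sum_(a : 'I_n) \sum_(e <- env_list vars_but_last zero_env | head_env e == x)
     F (set_var e last_var a).
Proof.
rewrite (partition_big (fun e : env => tnth e last_var) predT) //=.
apply: eq_bigr => a _.
rewrite [RHS]big_mkcond big_uniq /=; last exact: uniq_env_list uniq_vars_but_last.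
rewrite -big_mkcondr (reindex_onto (fun e => set_var e last_var a)
  (fun e => set_var e last_var (Ordinal n_gt0))) /=; last first.
  move=> e /andP [_ /eqP <-]; apply: eq_from_tnth => o; rewrite !tnth_set_var.
  by case: eqP => // ->.
apply: eq_bigl => e; rewrite head_set_last tnth_set_var eqxx eqxx andbT andbC.
congr (_ && _); rewrite mem_env_list; apply/eqP/forallP => [<- o|h].
  rewrite mem_filter mem_enum andbT !tnth_set_var tnth_nseq.
  by case: (o == last_var).
apply: eq_from_tnth => o; rewrite !tnth_set_var.
case: eqP => // ->; have := h last_var.
by rewrite mem_filter eqxx /= tnth_nseq => /eqP ->.
Qed.

(** Writing each count as a sum over objects and exchanging the sums leaves, for each object [a],
    only the term of its own type. *)
Lemma sum_type_parts x :
  \sum_(tau : {ffun 'I_r -> bool}) type_count tau * type_part tau x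
  = corrected set0 x.
Proof.
have countE tau : type_count tau = \sum_(a : 'I_n) (tau == type_of a).
  rewrite /type_count /= big_flatten big_map big_enum /=; apply: eq_bigr => a _.
  by rewrite big_seq1 holds_has_type tnth_set_var eqxx.
under eq_bigr do rewrite countE big_distrl.
rewrite exchange_big /= /corrected sum_by_last; apply: eq_bigr => a _.
rewrite (bigD1 (type_of a)) //= eqxx mul1n big1 ?addn0 => [|tau /negPf -> //].
by apply: eq_bigr => e _; rewrite in_set0 holds_unmixed_at.
Qed.

Definition covers (D : {set env}) (p : position) : Prop :=
  let: existT i (a, b, j) := p in
  forall rho (e : env), rho \in records S i -> tnth e j = tnth rho a ->
    tnth e last_var = tnth rho b -> e \in D.

(** A mixed atom true at [e] would provide a record and two positions whose covering puts [e] into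
    [D]. Outside [D] all mixed atoms are thus false, and phi and phi0 agree. *)
Lemma corrected_covering (D : {set env}) x :
  (forall p, p \in positions -> covers D p) ->
  corrected D x = \sum_(e : env | head_env e == x) holds e phi.
Proof.
move=> hD; apply: eq_bigr => e _; case: (boolP (e \in D)) => // he.
rewrite -[phi in RHS]map_atoms_id /unmixed; congr nat_of_bool.
apply: holds_map_atoms => i v; case: ifP => //.
rewrite holds_const /mixed => /andP [hl /allPn [o hv hj]].
apply/esym/negbTE; apply: contra he => /= hrho.
(* The positions in the atom of the other variable [o] and of the last variable. *)
have /tnthP [a ea] := hv; have /tnthP [b eb] := hl.
apply: (hD (existT _ i (a, b, o)) _ _ e hrho); last 2 first.
- by rewrite tnth_map -ea.
- by rewrite tnth_map -eb.
by rewrite mem_filter mem_enum andbT.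
Qed.

Definition tail_env (e : env) : l.-tuple 'I_n := [tuple tnth e (rshift k i) | i < l].

Lemma cat_head_tail (e : env) : cat_tuple (head_env e) (tail_env e) = e.
Proof.
apply: eq_from_tnth => o; rewrite -(splitK o); case: (split o) => i /=.
  by rewrite tnth_lshift tnth_mktuple.
by rewrite tnth_rshift tnth_mktuple.
Qed.

Lemma head_cat (x : k.-tuple 'I_n) (y : l.-tuple 'I_n) :
  head_env (cat_tuple x y) = x.
Proof. by apply: eq_from_tnth => i; rewrite tnth_mktuple tnth_lshift. Qed.

Lemma tail_cat (x : k.-tuple 'I_n) (y : l.-tuple 'I_n) :
  tail_env (cat_tuple x y) = y.
Proof. by apply: eq_from_tnth => i; rewrite tnth_mktuple tnth_rshift. Qed.

Lemma ValE (psi : optsp ar k l) (x : k.-tuple 'I_n) : body psi = phi ->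
  Val psi x = \sum_(e : env | head_env e == x) holds e phi.
Proof.
move=> e_phi; rewrite /Val e_phi -sum1_card big_mkcond /=.
rewrite [RHS](reindex_onto (cat_tuple x) tail_env) /=; last first.
  by move=> e /eqP <-; rewrite cat_head_tail.
apply: eq_big => y; first by rewrite head_cat tail_cat !eqxx.
by rewrite inE; case: holds.
Qed.

(** This bound makes the residues stored in the value table exact. *)
Lemma Val_lt (psi : optsp ar k l) (x : k.-tuple 'I_n) : Val psi x < 2 ^ w.
Proof.
apply: leq_ltn_trans region_lt; apply: leq_trans (max_card _) _.
by rewrite card_tuple card_ord; apply: exp_le_region; lia.
Qed.

Definition tables_cost : nat := \max_(i < r) (2 * ar i + size (centry i) + 3).
Definition count_cost : nat :=
  \max_(tau : {ffun 'I_r -> bool}) size (ccount depth0 (has_type tau)).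
Definition add_cost : nat :=
  \max_(tau : {ffun 'I_r -> bool}) size (cadd depth0 (unmixed_at tau)).
Definition correct_cost : nat :=
  \max_(i < r) size (ccorrect (depth0 + 2 + ar i)).

(** * Running time *)

Hypothesis q_gt1 : 1 < k + l.

(** Both [n] and [m] enter, since nothing bounds [n] by [m] at this stage. *)
Let T := (n + nrec S) ^ (k + l - 1).

Lemma size_records_nrec i : size (records S i) <= nrec S.
Proof. by rewrite /nrec (bigD1 i) //=; apply: leq_addr. Qed.

Lemma base_le_T : n + nrec S <= T.
Proof. by rewrite -{1}[n + _]expn1 leq_pexp2l; have := n_gt0; lia. Qed.

Lemma expn_le_T : n ^ (k + l - 1) <= T.
Proof. by rewrite leq_exp2r; lia. Qed.

Lemma mul_expn_le_T : nrec S * n ^ (k + l - 2) <= T.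
Proof.
rewrite /T (_ : k + l - 1 = (k + l - 2).+1) ?expnS; last by lia.
apply: leq_mul; first exact: leq_addl.
by case: (k + l - 2) => // e; rewrite leq_exp2r // leq_addr.
Qed.

(** As [n] is positive, a level costing [n * (c + 3) + 3] costs at most [n * (c + 6)]; this is the
    origin of the 6 per variable. *)
Lemma nest_cost_le t vs :
  nest_cost t vs <= (t + 6 * size vs) * n ^ size vs.
Proof.
elim: vs => [|v vs IH] /=; first by rewrite muln0 addn0 muln1.
have h : 0 < n ^ size vs by rewrite expn_gt0 n_gt0.
have hn := n_gt0; apply: (@leq_trans (n * (nest_cost t vs + 6))); first by lia.
rewrite expnS mulnCA leq_mul2l; apply/orP; right; nia.
Qed.

Lemma size_vars_but_last : size vars_but_last = k + l - 1.
Proof.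
have := count_predC (pred1 last_var) (enum 'I_(k + l)).
rewrite count_uniq_mem ?enum_uniq // mem_enum size_enum_ord.
rewrite size_filter (eq_count (a2 := predC (pred1 last_var))) //.
by move: (count _ _) => c; rewrite inE; lia.
Qed.

Lemma size_vars_but_two j : j != last_var ->
  size [seq v <- vars_but_last | v != j] = k + l - 2.
Proof.
move=> hj; have := count_predC (pred1 j) vars_but_last.
rewrite count_uniq_mem ?uniq_vars_but_last // mem_filter hj mem_enum.
rewrite size_vars_but_last size_filter.
rewrite (eq_count (a1 := fun v => v != j) (a2 := predC (pred1 j))) //.
by move: (count _ _) => c; rewrite inE; lia.
Qed.

Definition table_phase_cost : nat := tables_cost + 5.
Definition type_phase_cost : nat :=
  2 + 2 * (k + l) + (count_cost + 6) + (add_cost + 6 * (k + l)).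
(** The 12 is 5 steps around the record loop plus 7 per record: 4 to place the two values and 3 of
    loop overhead. *)
Definition mixed_phase_cost : nat :=
  12 + 2 * (\sum_(i < r) ar i) + correct_cost + 6 * (k + l).

Lemma wp_table_phase R0 M0 acc :
  glob R0 -> mem_inv M0 (fun=> [::]) set0 (fun=> 0) acc ->
  wp w (cseqs (enum 'I_r) ctable) (r * (table_phase_cost * T)) R0 M0
    (fun R' M' => agree_below depth0 R0 R' /\
       mem_inv M' (records S) set0 (fun=> 0) acc).
Proof.
move=> hg hM; pose I s (R M : nat -> nat) := agree_below depth0 R0 R /\
  mem_inv M (tables_of s) set0 (fun=> 0) acc.
rewrite -[in r * _](size_enum_ord r).
apply: wp_mono (wp_seqs (I := I) _ _) (leqnn _) _.
- move=> s1 i s2 R M sE [hR hI].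
  have hi : i \notin s1.
    have := enum_uniq 'I_r; rewrite sE cat_uniq => /and3P [_ /hasPn h _].
    by apply: h; rewrite inE eqxx.
  apply: wp_mono (wp_ctable (glob_agree hR hg) hi hI) _ _; last first.
    by move=> R' M' [hR' hI']; split => //; apply: agree_below_trans hR'.
  have h1 := size_records_nrec i; have h2 := base_le_T.
  have h3 : 2 * ar i + size (centry i) + 3 <= tables_cost.
    by rewrite /tables_cost (leq_bigmax i).
  have h4 : size (records S i) * (2 * ar i + size (centry i) + 3)
      <= T * tables_cost by apply: leq_mul => //; lia.
  by have := n_gt0; rewrite /table_phase_cost; nia.
- by split.
move=> R' M' [hR' [h1 h2 h3 h4 h5]]; split => //; split => // i rho.
by rewrite h2 /tables_of mem_enum.
Qed.

Lemma T_gt0 : 0 < T.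
Proof. by have := n_gt0; have := base_le_T; lia. Qed.

Lemma wp_type_phase R0 M0 acc :
  glob R0 -> mem_inv M0 (records S) set0 (fun=> 0) acc ->
  wp w (cseqs (enum {: {ffun 'I_r -> bool}}) ctype)
    (#|{: {ffun 'I_r -> bool}}| * (type_phase_cost * T)) R0 M0
    (fun R' M' => agree_below depth0 R0 R' /\ exists acc',
       mem_inv M' (records S) set0 (corrected set0) acc').
Proof.
move=> hg hM; pose I s (R M : nat -> nat) := agree_below depth0 R0 R /\
  exists acc', mem_inv M (records S) set0
    (fun x => \sum_(tau <- s) type_count tau * type_part tau x) acc'.
rewrite cardE; apply: wp_mono (wp_seqs (I := I) _ _) (leqnn _) _.
- move=> s1 tau s2 R M _ [hR [acc' hI]].
  apply: wp_mono (wp_ctype tau (glob_agree hR hg) hI) _ _; last first.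
    move=> R' M' [hR' hI']; split; first exact: agree_below_trans hR'.
    by exists (type_count tau); apply: mem_inv_ext hI' => x; rewrite big_rcons.
  have h1 := nest_cost_le (size (ccount depth0 (has_type tau))) [:: last_var].
  have h2 := nest_cost_le (size (cadd depth0 (unmixed_at tau))) vars_but_last.
  have h3 : size (ccount depth0 (has_type tau)) <= count_cost.
    by rewrite /count_cost (leq_bigmax tau).
  have h4 : size (cadd depth0 (unmixed_at tau)) <= add_cost.
    by rewrite /add_cost (leq_bigmax tau).
  have hT := T_gt0; have hn := base_le_T; have hq := expn_le_T.
  rewrite size_vars_but_last in h2.
  have {}h1 : nest_cost (size (ccount depth0 (has_type tau))) [:: last_var]
      <= (count_cost + 6) * T.
    apply: leq_trans h1 _; rewrite expn1; apply: leq_mul => /=; lia.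
  have {}h2 : nest_cost (size (cadd depth0 (unmixed_at tau))) vars_but_last
      <= (add_cost + 6 * (k + l)) * T.
    by apply: leq_trans h2 _; apply: leq_mul => //; lia.
  have h5 : 2 + 2 * (k + l) <= (2 + 2 * (k + l)) * T by rewrite leq_pmulr.
  rewrite /type_phase_cost mulnDl mulnDl; lia.
- by split => //; exists acc; apply: mem_inv_ext hM => x; rewrite big_nil.
move=> R' M' [hR' [acc' h]]; split => //; exists acc'.
by apply: mem_inv_ext h => x; rewrite big_enum sum_type_parts.
Qed.

Lemma wp_mixed_phase R0 M0 acc :
  glob R0 -> mem_inv M0 (records S) set0 (corrected set0) acc ->
  wp w (cseqs positions cmixed) (size positions * (mixed_phase_cost * T)) R0 M0
    (fun R' M' => agree_below depth0 R0 R' /\ exists D : {set env},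
       mem_inv M' (records S) D
         (fun x => \sum_(e : env | head_env e == x) holds e phi) acc).
Proof.
move=> hg hM; pose I (s : seq position) (R M : nat -> nat) := agree_below depth0 R0 R /\
  exists D : {set env}, mem_inv M (records S) D (corrected D) acc /\
    forall p, p \in s -> covers D p.
apply: wp_mono (wp_seqs (I := I) _ _) (leqnn _) _.
- move=> s1 p s2 R M sE [hR [D [hI hD]]].
  have : p \in positions by rewrite sE mem_cat inE eqxx orbT.
  rewrite mem_filter => /andP [+ _]; case: p sE => i [[a b] j] _ /= hj.
  apply: wp_mono (wp_cmixed a b (glob_agree hR hg) hj hI) _ _; last first.
    move=> R' M' [hR' [D' [hI' hD' hc]]]; split.
      exact: agree_below_trans hR'.
    exists D'; split => // p; rewrite mem_rcons inE => /orP [/eqP -> //|hp].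
    case: p hp => i' [[a' b'] j'] hp rho e h1 h2 h3.
    by apply: (subsetP hD'); apply: (hD _ hp) h1 h2 h3.
  have := nest_cost_le (size (ccorrect (depth0 + 2 + ar i)))
    [seq v <- vars_but_last | v != j].
  rewrite size_vars_but_two //.
  set c := nest_cost _ _ => hc.
  have hs : size (ccorrect (depth0 + 2 + ar i)) <= correct_cost.
    by rewrite /correct_cost (leq_bigmax i).
  have ha : ar i <= \sum_(i < r) ar i by rewrite (bigD1 i) //= leq_addr.
  have hT := T_gt0; have hm := mul_expn_le_T; have hr := size_records_nrec i.
  have hp : 0 < n ^ (k + l - 2) by rewrite expn_gt0 n_gt0.
  set x := n ^ (k + l - 2) in hc hm hp.
  set u := 7 + 2 * (\sum_(i < r) ar i) + correct_cost + 6 * (k + l).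
  have h1 : 2 * ar i + (4 + c) + 3 <= u * x.
    rewrite /u; apply: (@leq_trans ((7 + 2 * \sum_(i < r) ar i) * x +
      (correct_cost + 6 * (k + l)) * x)); last by rewrite -mulnDl addnA.
    have h2 : 7 + 2 * \sum_(i < r) ar i <= (7 + 2 * \sum_(i < r) ar i) * x.
      by rewrite leq_pmulr.
    have h3 : c <= (correct_cost + 6 * (k + l)) * x.
      by apply: leq_trans hc _; rewrite leq_mul2r; apply/orP; right; lia.
    lia.
  have h2 : size (records S i) * (2 * ar i + (4 + c) + 3) <= u * T.
    apply: (@leq_trans (nrec S * (u * x))); first exact: leq_mul.
    by rewrite mulnCA leq_mul2l hm orbT.
  have -> : mixed_phase_cost = 5 + u by rewrite /mixed_phase_cost /u; lia.
  rewrite mulnDl; lia.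
- by split => //; exists set0.
move=> R' M' [hR' [D [hI hD]]]; split => //; exists D.
by apply: mem_inv_ext hI => x; apply: corrected_covering.
Qed.

(** All arrays lie behind the input, where the initial memory is the default 0 of [nth]; so every
    table starts out empty at no cost. *)
Lemma mem_inv_init : mem_inv (nth 0 (encode S)) (fun=> [::]) set0 (fun=> 0) 0.
Proof.
have h j x : nth 0 (encode S) (cell j x) = 0.
  by rewrite nth_default // /cell -/insize; lia.
by split => [//|i rho|e|x|]; rewrite h ?mod0n ?in_nil ?in_set0.
Qed.

Definition main_cost : nat := r * table_phase_cost +
  #|{: {ffun 'I_r -> bool}}| * type_phase_cost +
  size positions * mixed_phase_cost.

Lemma wp_phases R0 :
  glob R0 ->
  wp w (cseq (cseqs (enum 'I_r) ctable)
       (cseq (cseqs (enum {: {ffun 'I_r -> bool}}) ctype)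
             (cseqs positions cmixed)))
    (main_cost * T) R0 (nth 0 (encode S))
    (fun R' M' => agree_below depth0 R0 R' /\ exists (D : {set env}) acc,
       mem_inv M' (records S) D
         (fun x => \sum_(e : env | head_env e == x) holds e phi) acc).
Proof.
move=> hg; rewrite /main_cost !mulnDl -addnA -!mulnA.
apply: wp_seq; apply: wp_mono (wp_table_phase hg mem_inv_init) (leqnn _) _.
move=> R1 M1 [hR1 hM1]; apply: wp_seq.
apply: wp_mono (wp_type_phase (glob_agree hR1 hg) hM1) (leqnn _) _.
move=> R2 M2 [hR2 [acc hM2]].
have {}hR2 := agree_below_trans hR1 hR2.
apply: wp_mono (wp_mixed_phase (glob_agree hR2 hg) hM2) (leqnn _) _.
move=> R3 M3 [hR3 [D hM3]]; split; first exact: agree_below_trans hR3.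
by exists D, acc.
Qed.

(** * Reading the input *)

Lemma size_flatten_uniform (U : Type) (ss : seq (seq U)) m :
  all (fun s => size s == m) ss -> size (flatten ss) = size ss * m.
Proof.
by elim: ss => //= s ss IH /andP [/eqP hs /IH e]; rewrite size_cat e hs mulSn.
Qed.

Lemma nth_flatten_uniform (U : Type) (x0 : U) s0 ss s2 m t a :
  all (fun s => size s == m) ss -> t < size ss -> a < m ->
  nth x0 (flatten ss ++ s2) (t * m + a) = nth x0 (nth s0 ss t) a.
Proof.
elim: ss t => //= s ss IH t /andP [/eqP hs hss] ht ha; rewrite -catA nth_cat hs.
case: t ht => [|t] ht; first by rewrite mul0n add0n ha.
by rewrite mulSn -addnA ltnNge leq_addr /= addKn IH.
Qed.

Let entries i := [seq [seq val o | o <- tval t] | t <- records S i].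
Let relation_block i := size (records S i) :: flatten (entries i).

Lemma all_size_entries i : all (fun s => size s == ar i) (entries i).
Proof. by rewrite all_map; apply/allP => t _ /=; rewrite size_map size_tuple. Qed.

Lemma encodeE s1 i s2 : enum 'I_r = s1 ++ i :: s2 ->
  encode S = (n :: flatten (map relation_block s1)) ++ size (records S i) ::
    flatten (entries i) ++ flatten (map relation_block s2).
Proof.
by move=> e; rewrite /encode e map_cat flatten_cat /=.
Qed.

Ltac regs := repeat first [rewrite upd_eq | rewrite upd_neq; [|lia]].

(** The pointer stands on the record count of relation [i]: the [.+1] accounts for the leading word
    [n], and the records begin one word later. *)
Lemma sp_scan s1 i s2 R Q :
  enum 'I_r = s1 ++ i :: s2 ->
  R depth0 = (size (flatten (map relation_block s1))).+1 -> R 1 = 1 ->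
  (forall R', agree_below (r + 6) R R' ->
     (forall j : 'I_r, j != i -> R' (rcnt j) = R (rcnt j) /\
        R' (rstart j) = R (rstart j)) ->
     R' depth0 = (size (flatten (map relation_block (rcons s1 i)))).+1 ->
     R' (rcnt i) = size (records S i) ->
     R' (rstart i) = (size (flatten (map relation_block s1))).+2 ->
     Q R' (nth 0 (encode S))) ->
  sp w [:: Read (rcnt i) depth0; Plus depth0 depth0 1; SetC (rstart i) 0;
           Plus (rstart i) (rstart i) depth0; SetC depth0.+1 (ar i);
           Times depth0.+1 depth0.+1 (rcnt i);
           Plus depth0 depth0 depth0.+1] R (nth 0 (encode S)) Q.
Proof.
move=> sE hp h1 hQ; have hi := ltn_ord i; have hW := word_gt3.
set p := size _ in hp hQ *.
have eE := encodeE sE.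
have hcnt : nth 0 (encode S) p.+1 = size (records S i).
  by rewrite eE nth_cat /= -/p ltnn subnn.
have hsz : insize = p.+2 + size (records S i) * ar i +
    size (flatten (map relation_block s2)).
  rewrite /insize eE !size_cat /= size_cat (size_flatten_uniform (all_size_entries i)).
  by rewrite [size (entries i)]size_map /p !(addSn, addnS) addnA.
have hinW : insize < 2 ^ w by have := region_gt0; nia.
have e0 : depth0 = 3 * r + 6 by [].
have e1 : rcnt i = 2 * r + 6 + i by [].
have e2 : rstart i = r + 6 + i by [].
refine (sp_read _); rewrite hp hcnt.
refine (sp_plus _ _); regs; rewrite hp h1; first by lia.
refine (sp_set _ _); first by lia.
refine (sp_plus _ _); regs; first by lia.
refine (sp_set _ _); first exact: word_ar.
refine (sp_times _ _); regs; first by lia.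
refine (sp_plus _ _); regs; first by lia.
refine (sp_nil _); apply: hQ.
- by move=> x hx; regs.
- move=> j ne; have hj := ltn_ord j; have {}ne : nat_of_ord j != i by [].
  by rewrite /rcnt /rstart; split; regs.
- regs; rewrite map_rcons flatten_rcons size_cat /= -/p.
  rewrite (size_flatten_uniform (all_size_entries i)) [size (entries i)]size_map.
  by rewrite !(addSn, addnS) addn0 mulnC.
- by regs.
- by regs; lia.
Qed.

Definition setup_cost : nat :=
  4 + (r * 7 + (1 + ((k + l + \sum_(i < r) ar i) * 1 + (2 + (r + 2) * 1)))).

Lemma wp_csetup :
  wp w csetup setup_cost (fun=> 0) (nth 0 (encode S))
    (fun R' M' => glob R' /\ M' = nth 0 (encode S)).
Proof.
have hW := word_gt3; have hreg := region_gt0.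
have hinW : insize < 2 ^ w by nia.
have hd0 : depth0 = 3 * r + 6 by [].
apply: wp_seq; apply: wp_block => //.
refine (sp_set _ _); first by lia.
refine (sp_set _ _); first by lia.
refine (sp_read _); refine (sp_set _ _); first by lia.
regs; refine (sp_nil _).
have -> : nth 0 (encode S) 0 = n by [].
set R1 := upd _ _ _.
pose I (s : seq 'I_r) (R M : nat -> nat) :=
  [/\ M = nth 0 (encode S), R 1 = 1, R 2 = n,
      R depth0 = (size (flatten (map relation_block s))).+1
    & forall i, i \in s -> R (rcnt i) = size (records S i) /\
        R (rstart i) + size (records S i) * ar i <= insize /\
        forall t (a : 'I_(ar i)) rho0, t < size (records S i) ->
          nth 0 (encode S) (R (rstart i) + t * ar i + a)
          = tnth (nth rho0 (records S i) t) a].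
apply: wp_seq; rewrite -[in r * 7](size_enum_ord r).
apply: wp_mono (wp_seqs (I := I) _ _) (leqnn _) _.
- move=> s1 i s2 R _ sE [-> h1 h2 hp hI]; apply: wp_block => //.
  apply: (sp_scan sE) => // R' hR' hne hp' hc hs; split => //.
  + by rewrite hR' //; lia.
  + by rewrite hR' //; lia.
  move=> j; rewrite mem_rcons inE; case: (eqVneq j i) => [-> _|ne /= hj].
    split=> //; rewrite hs (encodeE sE) /insize (encodeE sE).
    set p := size _; split.
      rewrite !size_cat /= size_cat (size_flatten_uniform (all_size_entries i)).
      by rewrite [size (entries i)]size_map /p !(addSn, addnS) addnA leq_addr.
    move=> t a rho0 ht; rewrite nth_cat /= ifN; last by lia.
    rewrite (_ : p.+2 + t * ar i + a - _ = (t * ar i + a).+1) /=; last by lia.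
    rewrite (nth_flatten_uniform _ [::] _ (all_size_entries i)) ?size_map //.
    by rewrite (nth_map rho0) // (nth_map (tnth (nth rho0 (records S i) t) a))
      ?size_tuple // -tnth_nth.
  by have [-> ->] := hne j ne; apply: hI.
- by split => //; rewrite /R1; regs.
(* With all relations scanned, the pointer equals the length of the input, the first free
   address. *)
move=> R2 _ [-> h1 h2 hp hI]; have {}hp : R2 depth0 = insize.
  by rewrite hp /insize /encode.
apply: wp_seq; apply: wp_block => //.
refine (sp_set _ _); first by lia.
refine (sp_nil _); set R3 := upd _ _ _.
pose A := k + l + \sum_(i < r) ar i.
pose I2 (s : seq nat) (R M : nat -> nat) := [/\ M = nth 0 (encode S),
  agree_below depth0.+1 R2 R & R depth0.+1 = n ^ size s].
apply: wp_seq; rewrite -[in (k + l + _) * 1](size_iota 0 (k + l + _)).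
apply: wp_mono (wp_seqs (I := I2) _ _) (leqnn _) _.
- move=> s1 x s2 R _ sE [-> hR hx]; apply: wp_block => //.
  have hs : (size s1).+1 <= A.
    by have := congr1 size sE; rewrite size_iota size_cat /= -/A; lia.
  have hlt : n ^ (size s1).+1 < 2 ^ w.
    by apply: leq_ltn_trans region_lt; apply: exp_le_region.
  have e2 : R 2 = n by rewrite hR ?h2; lia.
  refine (sp_times _ _); rewrite hx e2 -expnSr //.
  by refine (sp_nil _); split => //; rewrite ?upd_eq ?size_rcons //;
    apply: agree_below_upd.
- by split => //; rewrite /R3 ?upd_eq //; apply: agree_below_upd.
move=> R4 _ [-> hR4 hg4]; rewrite size_iota -/region in hg4.
have {}hR4 : agree_below depth0.+1 R2 R4 by [].
apply: wp_seq; apply: wp_block => //.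
refine (sp_set _ _); first by lia.
have hb0 : rbase 0 = 3 by [].
refine (sp_plus _ _); regs; rewrite hR4 ?hp ?add0n //.
refine (sp_nil _); set R5 := upd _ _ _.
(* Each array base is the previous one plus [region]. The bases occupy registers 3 to [r + 5], and
   all others keep their content. *)
pose I3 (s : seq nat) (R M : nat -> nat) := [/\ M = nth 0 (encode S),
  forall x, x < 3 \/ r + 6 <= x -> R x = R4 x &
  forall j, j <= size s -> R (rbase j) = cell j 0].
rewrite -[in (r + 2) * 1](size_iota 0 (r + 2)).
apply: wp_mono (wp_seqs (I := I3) _ _) (leqnn _) _.
- move=> s1 j s2 R _ sE [-> hR hj]; apply: wp_block => //.
  have sz : size s1 + size s2 + 1 = r + 2.
    by have := congr1 size sE; rewrite size_iota size_cat /=; lia.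
  have jE : j = size s1.
    have := congr1 (nth 0 ^~ (size s1)) sE.
    by rewrite nth_cat ltnn subnn /= nth_iota; lia.
  have eb : R (rbase j) = cell j 0 by rewrite hj ?jE.
  have eg : R depth0.+1 = region by rewrite hR ?hg4; lia.
  have ec : cell j 0 + region = cell j.+1 0 by rewrite /cell; lia.
  refine (sp_plus _ _); rewrite eb eg ec; first by apply: cell_lt; lia.
  refine (sp_nil _); split => //.
    by move=> x hx; rewrite upd_neq ?hR //; rewrite /rbase; lia.
  move=> j'; rewrite size_rcons => hj'; rewrite /rbase.
  case: (eqVneq j' j.+1) => [->|ne]; first by rewrite upd_eq.
  by rewrite upd_neq ?hj; lia.
- split => //.
    by move=> x hx; rewrite /R5; regs.
  by case=> // _; rewrite /R5 upd_eq /cell; lia.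
move=> R6 _ [-> hR6 hb6]; split => //; split.
- by rewrite hR6 ?hR4 ?h1; lia.
- by rewrite hR6 ?hR4 ?h2; lia.
- by move=> j hj; rewrite hb6 // size_iota; lia.
- move=> i; have [hc _] := hI i (mem_enum _ i); have hi := ltn_ord i.
  by rewrite hR6 ?hR4 ?hc // /rcnt; lia.
move=> i; have [_ hs] := hI i (mem_enum _ i); have hi := ltn_ord i.
by rewrite hR6 ?hR4 // /rstart; lia.
Qed.

(** * Output *)

Lemma wp_cvalues :
  wp w cvalues (setup_cost + main_cost * T) (fun=> 0) (nth 0 (encode S))
    (fun R' M' => glob R' /\ exists (D : {set env}) acc,
       mem_inv M' (records S) D
         (fun x => \sum_(e : env | head_env e == x) holds e phi) acc).
Proof.
apply: wp_seq; apply: wp_mono wp_csetup (leqnn _) _ => R M [hg ->].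
apply: wp_mono (wp_phases hg) (leqnn _) _ => R' M' [hR' hM'].
by split => //; apply: glob_agree hg.
Qed.

Variable psi : optsp ar k l.
Hypothesis body_psi : body psi = phi.

Lemma mem_inv_Val M D acc :
  mem_inv M (records S) D
    (fun x => \sum_(e : env | head_env e == x) holds e phi) acc ->
  mem_inv M (records S) D (fun x => Val psi x) acc.
Proof. by apply: mem_inv_ext => x; rewrite (ValE _ body_psi). Qed.

Lemma wp_cout_values R M D acc :
  glob R -> mem_inv M (records S) D (fun x => Val psi x) acc ->
  wp w cout_values 2 R M (fun R' M' => forall x : k.-tuple 'I_n,
    M' (R' 0 + tuple_index x) = Val psi x).
Proof.
move=> [_ _ hb _ _] [_ _ _ hV _]; have hW := word_gt3.
have hc : cell r.+1 0 < 2 ^ w by apply: cell_lt; [lia|exact: region_gt0].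
have hb' : R (rbase r.+1) = cell r.+1 0 by apply: hb; lia.
apply: wp_block => //; refine (sp_set _ _); first by lia.
refine (sp_plus _ _); rewrite upd_eq upd_neq // hb' add0n //.
refine (sp_nil _) => x; rewrite upd_eq tuple_indexE.
have -> : cell r.+1 0 + idx n [seq val o | o <- x]
    = cell r.+1 (idx n [seq val o | o <- x]) by rewrite /cell addn0.
by rewrite hV modn_small // Val_lt.
Qed.

(** [v] is at least as good as [u] in the direction of optimization. *)
Definition at_least (dir : direction) (v u : nat) : bool :=
  match dir with Max => u <= v | Min => v <= u end.

Lemma at_least_trans dir v u u' :
  at_least dir v u -> at_least dir u u' -> at_least dir v u'.
Proof. by case: dir => /= h1 h2; [apply: leq_trans h1|apply: leq_trans h2]. Qed.

Definition better_size : nat :=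
  size (caddr (depth0 + (k + l)) r.+1 (head_regs depth0) ++
    [:: Read (depth0 + (k + l)).+1 (depth0 + (k + l));
        Read (depth0 + (k + l)).+2 (rbase r.+2)]).

(** The accumulator always equals the value of some tuple; this witness becomes the attainment half
    of [is_optimum]. *)
Lemma wp_cbetter dir R M D (x0 : k.-tuple 'I_n) e :
  glob R -> holds_env R depth0 e ->
  mem_inv M (records S) D (fun x => Val psi x) (Val psi x0) ->
  wp w (cbetter dir depth0) (better_size + (1 + 2)) R M (fun R' M' =>
    agree_below (depth0 + (k + l)) R R' /\ exists x1 : k.-tuple 'I_n,
    [/\ mem_inv M' (records S) D (fun x => Val psi x) (Val psi x1),
        at_least dir (Val psi x1) (Val psi x0) &
        at_least dir (Val psi x1) (Val psi (head_env e))]).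
Proof.
move=> hg he hM; have [_ _ _ hV hacc] := hM; rewrite /cbetter.
set d := depth0 + (k + l); have hW := word_gt3.
have hd0 : depth0 <= d by rewrite leq_addr.
apply: wp_seq; apply: wp_block; first by rewrite all_cat straight_caddr.
apply: (sp_caddr_head (Z := depth0) (e := e)) => // R1 hR1 eR1.
have [_ _ hb _ _] : glob R1 := glob_agree (agree_below_leq hd0 hR1) hg.
have hbd : rbase r.+2 < d by rewrite /rbase /d /depth0; lia.
refine (sp_read _); rewrite eR1 hV.
refine (sp_read _); rewrite (@upd_neq _ d.+1) ?hb ?hacc; [|lia|lia].
refine (sp_nil _); rewrite !modn_small ?Val_lt //.
set R2 := upd _ _ _.
have hR2 : agree_below d R R2 by do 2! [apply: agree_below_upd; last by lia].
have e1 : R2 d.+1 = Val psi (head_env e) by rewrite /R2 upd_neq ?upd_eq; lia.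
have e2 : R2 d.+2 = Val psi x0 by rewrite /R2 upd_eq.
have eb : R2 (rbase r.+2) = cell r.+2 0 by rewrite /R2 !upd_neq ?hb; lia.
have hwrite : wp w (block [:: Write (rbase r.+2) d.+1]) 1 R2 M (fun R' M' =>
    R' = R2 /\ mem_inv M' (records S) D (fun x => Val psi x)
      (Val psi (head_env e))).
  apply: wp_block => //; refine (sp_write _); rewrite e1 eb.
  refine (sp_nil _); split => //.
  by rewrite -[X in upd _ _ X](modn_small (Val_lt psi (head_env e)));
    apply: mem_inv_acc hM.
case: dir; apply: wp_when_lt; rewrite e1 e2 => h.
- apply: wp_mono hwrite (leqnn _) _ => R' M' [-> hM']; split => //.
  by exists (head_env e); split => //=; rewrite ltnW.
- by split => //; exists x0; split => /=.
- apply: wp_mono hwrite (leqnn _) _ => R' M' [-> hM']; split => //.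
  by exists (head_env e); split => //=; rewrite ltnW.
- by split => //; exists x0; split => /=.
Qed.

Lemma idx_zero s : all (pred1 0) s -> idx n s = 0.
Proof. by rewrite /idx; elim: s => //= x s IH /andP [/eqP ->]; rewrite mul0n; apply: IH. Qed.

Let heads : seq 'I_(k + l) := [seq lshift l i | i <- enum 'I_k].

Lemma uniq_heads : uniq heads.
Proof. by rewrite map_inj_uniq ?enum_uniq //; apply: lshift_inj. Qed.

Lemma heads_cover (x : k.-tuple 'I_n) :
  exists2 e, e \in env_list heads zero_env & head_env e = x.
Proof.
exists (cat_tuple x (nseq_tuple l (Ordinal n_gt0))); last exact: head_cat.
rewrite mem_env_list; apply/forallP => o; rewrite -(splitK o).
case: (split o) => i /=; first by rewrite map_f ?mem_enum.
by rewrite tnth_rshift !tnth_nseq eqxx orbT.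
Qed.

Lemma wp_cout_optimum R0 M0 D acc :
  glob R0 -> mem_inv M0 (records S) D (fun x => Val psi x) acc ->
  wp w (cout_optimum (opt psi))
    (2 + (k + l + (nest_cost (better_size + (1 + 2)) heads + 1))) R0 M0
    (fun R' M' => is_optimum psi S (R' 0)).
Proof.
move=> hg hM; have hW := word_gt3; have [_ _ hb _ _] := hg.
have hd : rbase r.+2 != depth0 by rewrite /rbase /depth0; lia.
have [_ _ _ hV _] := hM.
apply: wp_seq; apply: wp_block => //.
refine (sp_read _); rewrite hb; last by lia.
(* The first cell of the value array belongs to the zero tuple, whose value is the initial
   candidate. *)
have -> : M0 (cell r.+1 0) = Val psi (head_env zero_env) %% 2 ^ w.
  rewrite -hV idx_zero // all_map; apply/allP => o /tnthP [i ->] /=.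
  by rewrite tnth_mktuple tnth_nseq.
refine (sp_write _); rewrite upd_eq upd_neq // hb; last by lia.
refine (sp_nil _).
have := mem_inv_acc (Val psi (head_env zero_env)) hM.
move: (upd M0 _ _) => M1 {}hM.
set R1 := upd _ _ _; have hR1 : agree_below depth0 R0 R1 by apply: agree_below_upd.
apply: wp_seq; apply: wp_czero => R2 hR2 he2.
have {}hR2 := agree_below_trans hR1 hR2.
pose I (s : seq env) M := exists x : k.-tuple 'I_n,
  mem_inv M (records S) D (fun x => Val psi x) (Val psi x) /\
  forall e, e \in s -> at_least (opt psi) (Val psi x) (Val psi (head_env e)).
apply: wp_seq; apply: wp_mono (wp_nest (I := I) (leqnn _) hg _
    (vs := heads) (done := [::]) (e := zero_env) uniq_heads hR2 _ _) (leqnn _) _.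
- move=> s e R M hR he [x0 [hI hs]].
  apply: wp_mono (wp_cbetter (opt psi) (glob_agree hR hg) he hI) (leqnn _) _.
  move=> R' M' [hR' [x1 [hM' h0 h1]]]; split => //; exists x1; split => // e'.
  rewrite mem_rcons inE => /orP [/eqP -> //|/hs]; exact: at_least_trans.
- by move=> o _; apply: he2.
- by exists (head_env zero_env).
move=> R3 M3 [hR3 [x [[_ _ _ _ hacc] hx]]].
apply: wp_block => //; refine (sp_read _).
have -> : R3 (rbase r.+2) = cell r.+2 0.
  rewrite hR3 ?hR2 ?hb //; try by rewrite /rbase /depth0; lia.
  by apply/mapP => -[v _]; rewrite /rbase /depth0; lia.
rewrite hacc modn_small ?Val_lt //; refine (sp_nil _).
rewrite upd_eq; split; first by exists x.
move=> x'; have [e he <-] := heads_cover x'.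
by have := hx e he; rewrite /at_least; case: (opt psi).
Qed.

Definition optimum_cost : nat :=
  3 + (k + l) + (better_size + 3 + 6 * k).

(** The scan visits [n ^ k] tuples, which is affordable because [l] is at least 1. *)
Lemma optimum_cost_le :
  2 + (k + l + (nest_cost (better_size + (1 + 2)) heads + 1)) <= optimum_cost * T.
Proof.
have h := nest_cost_le (better_size + (1 + 2)) heads.
have hs : size heads = k by rewrite size_map size_enum_ord.
rewrite hs in h; have hT := T_gt0.
have hk : n ^ k <= T.
  by apply: leq_trans expn_le_T; rewrite leq_pexp2l ?n_gt0 //; lia.
have h1 : nest_cost (better_size + (1 + 2)) heads <= (better_size + 3 + 6 * k) * T.
  by apply: leq_trans h _; apply: leq_mul.
have h2 : 3 + (k + l) <= (3 + (k + l)) * T by rewrite leq_pmulr.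
by rewrite /optimum_cost mulnDl; lia.
Qed.

End Machine.
End Program.

(** * Word length and assembly of the two programs *)

Lemma size_encode (r : nat) (ar : 'I_r -> nat) (S : structure ar) :
  size (encode S) <= 1 + r + (\sum_(i < r) ar i) * nrec S.
Proof.
have -> : size (encode S) = 1 + \sum_(i < r) (1 + size (records S i) * ar i).
  rewrite /= size_flatten /shape -map_comp sumnE big_map big_enum add1n.
  congr _.+1; apply: eq_bigr => i _ /=.
  by rewrite (size_flatten_uniform (all_size_entries S i)) size_map add1n.
rewrite big_split /= sum_nat_const card_ord muln1 -addnA !leq_add2l.
rewrite big_distrl /=; apply: leq_sum => i _.
by rewrite mulnC leq_mul2l size_records_nrec orbT.
Qed.

(** With N = n + m + 2 and a the sum of the arities, N ^ (a + r + 3) absorbs the constant factor a +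
    r + 3, and one further factor N absorbs the sum of input length and array length. *)
Lemma word_size (r : nat) (ar : 'I_r -> nat) (k l : nat) (S : structure ar) (w : nat) :
  1 < k + l -> 0 < nrec S ->
  (nobj S + nrec S + 2) ^
    (\sum_(i < r) ar i + r + 3 + (k + l + \sum_(i < r) ar i).+1) <= 2 ^ w ->
  insize S + (r + 3) * region k l S <= 2 ^ w /\ forall i, ar i < 2 ^ w.
Proof.
set a := \sum_(i < r) ar i; set N := nobj S + nrec S + 2 => hkl hm hw.
have hn := nobj_gt0 S.
have N_gt1 : 1 < N by rewrite /N; lia.
have ha : a + r + 3 < N ^ (a + r + 3) by apply: ltn_expl.
have hNA : N <= N ^ (k + l + a) by rewrite -{1}[N]expn1 leq_pexp2l //; lia.
have hreg : region k l S <= N ^ (k + l + a).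
  by rewrite /region -/a leq_exp2r /N; lia.
have hin : insize S <= (a + r + 3) * N.
  by apply: leq_trans (size_encode S) _; rewrite -/a /N; nia.
have hpow : N + N ^ (k + l + a) <= N ^ (k + l + a).+1 by rewrite expnS; nia.
have hle : (a + r + 3) * (N + N ^ (k + l + a)) <= 2 ^ w.
  by apply: leq_trans hw; rewrite (expnD N (a + r + 3)); apply: leq_mul => //; apply: ltnW.
split.
  apply: leq_trans hle; rewrite mulnDr; apply: leq_add => //.
  by apply: leq_mul => //; lia.
move=> i; apply: leq_trans hle.
have : ar i <= a by rewrite /a (bigD1 i) //= leq_addr.
by nia.
Qed.

(** From [n <= b * m] follows n + m <= (b + 1) * m, so only the constant depends on [b], not the
    program or the word length. As [n] is positive, so is [m]. *)
Lemma computable_of_wp (r : nat) (ar : 'I_r -> nat) (k l : nat)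
    (output : structure ar -> config -> Prop) (c : code) (K : nat) :
  1 < k + l ->
  (forall (S : structure ar) w,
     insize S + (r + 3) * region k l S <= 2 ^ w ->
     (forall i, ar i < 2 ^ w) ->
     wp w c (K * (nobj S + nrec S) ^ (k + l - 1)) (fun=> 0) (nth 0 (encode S))
       (fun R M => forall pc, output S (Config pc R M))) ->
  computable_in_time (fun m => m ^ (k + l - 1)) output.
Proof.
move=> hkl hc.
exists (c 0), (\sum_(i < r) ar i + r + 3 + (k + l + \sum_(i < r) ar i).+1) => b.
exists (K * b.+1 ^ (k + l - 1)) => S hn w hw.
have hm : 0 < nrec S by have := nobj_gt0 S; nia.
have [h1 h2] := word_size hkl hm hw.
have [t [R [M [ht e q]]]] := wpE (hc S w h1 h2).
exists t; rewrite /init e; split => //.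
  apply: leq_trans ht _; rewrite -mulnA leq_mul2l -expnMn.
  by rewrite leq_exp2r ?orbT //; lia.
by rewrite /halted.
Qed.

Theorem theorem19 (r : nat) (ar : 'I_r -> nat) (k l : nat)
    (psi : optsp ar k l) (hl : 1 <= l) (hkl : 2 <= k + l) :
  computable_in_time (fun m => m ^ (k + l - 1)) (outputs_optimum psi) /\
  computable_in_time (fun m => m ^ (k + l - 1)) (outputs_values psi).
Proof.
have q_gt0 : 0 < k + l by lia.
pose phi := body psi.
(* The constant setup time is absorbed into the coefficient, the bound being at least 1. *)
pose K0 := setup_cost ar k l + main_cost q_gt0 phi.
have hK0 (T : nat) : 0 < T ->
    setup_cost ar k l + main_cost q_gt0 phi * T <= K0 * T.
  by move=> hT; rewrite (mulnDl (setup_cost ar k l)) leq_add2r leq_pmulr.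
have T_gt0 (S : structure ar) : 0 < (nobj S + nrec S) ^ (k + l - 1).
  by rewrite expn_gt0; have := nobj_gt0 S; lia.
split.
- refine (@computable_of_wp r ar k l _
    (cseq (cvalues q_gt0 phi) (cout_optimum r k l (opt psi)))
    (K0 + optimum_cost r k l) hkl _) => S w h1 h2; rewrite (mulnDl K0).
  apply: wp_seq; apply: wp_mono (wp_cvalues q_gt0 phi h1 h2 hl hkl) (hK0 _ (T_gt0 S)) _.
  move=> R M [hg [D [acc /(mem_inv_Val (erefl phi)) hM]]].
  apply: wp_mono (wp_cout_optimum q_gt0 h1 hl hkl hg hM) _ _.
    exact: (optimum_cost_le q_gt0 h1 hl hkl).
  by [].
- refine (@computable_of_wp r ar k l _
    (cseq (cvalues q_gt0 phi) (cout_values r)) (K0 + 2) hkl _) => S w h1 h2.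
  rewrite (mulnDl K0).
  apply: wp_seq; apply: wp_mono (wp_cvalues q_gt0 phi h1 h2 hl hkl) (hK0 _ (T_gt0 S)) _.
  move=> R M [hg [D [acc /(mem_inv_Val (erefl phi)) hM]]].
  apply: wp_mono (wp_cout_values q_gt0 h1 hl hkl hg hM) _ _.
    by rewrite leq_pmulr.
  by [].
Qed.
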